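(* Let $G$ be a finite abelian group, $I\subset D\subset G$ subgroups with $D/I$ cyclic, $\varphi$ a generator of $D/I$, and $A=\mathbb{Z}[G/I]/(g)$ with $g=1-\varphi^{-1}+\#I$. Let $I=I_1\times\cdots\times I_s$ be any decomposition into cyclic subgroups (some possibly trivial), and let $\mathcal{J}$ be the ideal defined below. Then \[ h\,\mathrm{Fitt}^{[1]}_{\mathbb{Z}[G]}(A)=\Bigl(\nu_I,\ \bigl(1-\tfrac{\nu_I}{\#I}\varphi^{-1}\bigr)\mathcal{J}\Bigr) \] as fractional ideals of $\mathbb{Z}[G]$.
   Context: $\nu_I=\sum_{\tau\in I}\tau$; $h=1-\frac{\nu_I}{\#I}\varphi^{-1}+\nu_I\in\mathbb{Q}[G]$, where $\nu_I\varphi^{-1}$ means $\nu_I\tilde\varphi^{-1}$ for any lift $\tilde\varphi\in D$ of $\varphi$ (independent of the lift); $g\in\mathbb{Z}[G/I]$ and $h$ are non-zero-divisors. For $1\le l\le s$ put $\nu_l=\sum_{\sigma\in I_l}\sigma$. For $0\le i\le s$, $Z_i$ is the ideal of $\mathbb{Z}[G]$ generated by all products $\nu_{l_1}\cdots\nu_{l_{s-i}}$ with $1\le l_1<\cdots<l_{s-i}\le s$ (so $Z_s=(1)$). $\mathcal{I}_D=\mathrm{Ker}(\mathbb{Z}[G]\to\mathbb{Z}[G/D])$, and $\mathcal{J}=\sum_{i=1}^s Z_i\mathcal{I}_D^{i-1}$. For a finite $\mathbb{Z}[G]$-module $X$, $\mathrm{Fitt}^{[1]}_{\mathbb{Z}[G]}(X)=\mathrm{Fitt}_{\mathbb{Z}[G]}(P)^{-1}\mathrm{Fitt}_{\mathbb{Z}[G]}(Y)$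 for any exact sequence $0\to Y\to P\to X\to0$ of finite $\mathbb{Z}[G]$-modules with $\mathrm{pd}_{\mathbb{Z}[G]}P\le1$ (independent of choice; $\mathrm{Fitt}(P)$ is generated by a non-zero-divisor). Fractional ideals are finitely generated $\mathbb{Z}[G]$-submodules of $\mathbb{Q}[G]$. *)

(* Defs.v *)
From HB Require Import structures.
From mathcomp Require Import all_boot all_algebra all_fingroup all_solvable.
From mathcomp Require Import generic_quotient ring_quotient.
From mathcomp Require Import boolp classical_sets cardinality.

Set Implicit Arguments.
Unset Strict Implicit.
Unset Printing Implicit Defensive.

Import GRing.Theory.
Local Open Scope classical_set_scope.
Local Open Scope ring_scope.

HB.mixin Record isAbelianGroup T of FinGroup T := {
  mulgC_subproof : forall x y : T, (x * y = y * x)%g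
}.

#[short(type="finAbGroupType")]
HB.structure Definition FinAbGroup := {T of FinGroup T & isAbelianGroup T}.

Lemma abgC (G : finAbGroupType) (x y : G) : (x * y = y * x)%g.
Proof. exact: mulgC_subproof. Qed.

Lemma abg_norm (G : finAbGroupType) (A : {set G}) (x : G) : x \in 'N(A)%g.
Proof.
apply: (fintype.subsetP (cent_sub A)); apply/centP => y _; exact: abgC.
Qed.

Section QuotientAb.
Variables (G : finAbGroupType) (A : {set G}).

Lemma coset_abC (x y : coset_of A) : (x * y = y * x)%g.
Proof.
have [a aN ->] := cosetP x; have [b bN ->] := cosetP y.
by rewrite -!morphM // abgC.
Qed.

HB.instance Definition _ := isAbelianGroup.Build (coset_of A) coset_abC.
End QuotientAb.

(* The group ring R[G]: an element is its function of coefficients.  The alias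
   hides the pointwise product of {ffun G -> R}. *)
Definition gring (R : comNzRingType) (G : finAbGroupType) : Type :=
  {ffun G -> R}.

Section GroupRing.
Variables (R : comNzRingType) (G : finAbGroupType).
Local Notation RG := (gring R G).

HB.instance Definition _ := GRing.Zmodule.on RG.

Definition gcoef (a : RG) (x : G) : R := (a : {ffun G -> R}) x.

Definition gelt (x : G) : RG := [ffun y => (y == x)%:R].

Definition gring_mul (a b : RG) : RG :=
  [ffun x => \sum_y gcoef a y * gcoef b (y^-1 * x)%g].

Lemma gringP (a b : RG) : gcoef a =1 gcoef b -> a = b.
Proof. by move=> ab; apply/ffunP. Qed.

Lemma gcoefD (a b : RG) x : gcoef (a + b) x = gcoef a x + gcoef b x.
Proof. by rewrite /gcoef ffunE. Qed.

Lemma gcoefM (a b : RG) x :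
  gcoef (gring_mul a b) x = \sum_y gcoef a y * gcoef b (y^-1 * x)%g.
Proof. by rewrite /gcoef ffunE. Qed.

Lemma gcoef_elt x y : gcoef (gelt x) y = (y == x)%:R.
Proof. by rewrite /gcoef ffunE. Qed.

Lemma gring_mulC : commutative gring_mul.
Proof.
move=> a b; apply: gringP => x; rewrite !gcoefM.
rewrite [LHS](reindex_inj invg_inj) [LHS](reindex_inj (mulIg x^-1%g)) /=.
apply: eq_bigr => y _.
by rewrite invgK mulgKV invMg invgK (abgC x) mulrC.
Qed.

Lemma gring_mulA : associative gring_mul.
Proof.
move=> a b c; apply: gringP => x; rewrite !gcoefM.
under [RHS]eq_bigr => y _ do rewrite gcoefM mulr_suml.
rewrite exchange_big /=; apply: eq_bigr => z _.
rewrite gcoefM mulr_sumr (reindex_inj (mulgI z^-1%g)) /=.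
apply: eq_bigr => y _.
by rewrite invMg invgK mulrA mulgA mulgK.
Qed.

Lemma gring_mul1 : left_id (gelt 1%g) gring_mul.
Proof.
move=> a; apply: gringP => x; rewrite gcoefM (bigD1 1%g) //= big1 => [|y ny].
  by rewrite gcoef_elt eqxx mul1r addr0 invg1 mul1g.
by rewrite gcoef_elt (negbTE ny) mul0r.
Qed.

Lemma gring_mulDl : left_distributive gring_mul +%R.
Proof.
move=> a b c; apply: gringP => x; rewrite gcoefD !gcoefM -big_split.
by apply: eq_bigr => y _; rewrite gcoefD mulrDl.
Qed.

Lemma gring_1_neq0 : gelt 1%g != 0.
Proof.
apply/eqP => /(congr1 (gcoef^~ 1%g)).
rewrite gcoef_elt eqxx /gcoef ffunE; apply/eqP; exact: oner_neq0.
Qed.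

HB.instance Definition _ := GRing.Zmodule_isComNzRing.Build RG
  gring_mulA gring_mulC gring_mul1 gring_mulDl gring_1_neq0.

Definition gconst (c : R) : RG := [ffun y => if y == 1%g then c else 0].

Definition gsum (H : {set G}) : RG := \sum_(x in H) gelt x.

End GroupRing.

Section Projection.
Variables (R : comNzRingType) (G : finAbGroupType) (H : {group G}).

(* R[G] -> R[G/H] *)
Definition gproj (a : gring R G) : gring R (coset_of H) :=
  [ffun y => \sum_(x | coset H x == y) gcoef a x].

Lemma gprojE a y : gcoef (gproj a) y = \sum_(x | coset H x == y) gcoef a x.
Proof. by rewrite /gcoef ffunE. Qed.

Lemma gproj_is_zmod_morphism : zmod_morphism gproj.
Proof.
move=> a b; apply/ffunP => y; rewrite !ffunE -sumrB; apply: eq_bigr => x _.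
by rewrite /gcoef !ffunE.
Qed.

Lemma gproj_is_monoid_morphism : monoid_morphism gproj.
Proof.
split.
  apply: gringP => y; rewrite gprojE gcoef_elt.
  under eq_bigr => x _ do rewrite gcoef_elt.
  rewrite big_mkcond (bigD1 1%g) //= big1 => [|x nx]; last first.
    by rewrite (negbTE nx); case: ifP.
  by rewrite eqxx addr0 (morph1 (coset H)) eq_sym; case: ifP.
move=> a b; apply: gringP => z; rewrite gprojE gcoefM.
under eq_bigr => x _ do rewrite gcoefM.
rewrite exchange_big /= (partition_big (coset H) predT) //=.
apply: eq_bigr => w _; rewrite gprojE mulr_suml; apply: eq_bigr => y /eqP yw.
rewrite -mulr_sumr gprojE; congr (_ * _).
rewrite (reindex_inj (mulgI y)) /=; apply: eq_big => [x|x _].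
  by rewrite morphM ?abg_norm // -yw -(inj_eq (mulgI (coset H y)^-1%g)) mulKg.
by rewrite mulKg.
Qed.

HB.instance Definition _ := GRing.isZmodMorphism.Build _ _ gproj
  gproj_is_zmod_morphism.
HB.instance Definition _ := GRing.isMonoidMorphism.Build _ _ gproj
  gproj_is_monoid_morphism.

End Projection.

Section RationalGroupRing.
Variable G : finAbGroupType.
Local Notation ZG := (gring int G).
Local Notation QG := (gring rat G).

Definition gratr (a : ZG) : QG := [ffun x => (gcoef a x)%:~R].

Lemma gratrE a x : gcoef (gratr a) x = (gcoef a x)%:~R.
Proof. by rewrite /gcoef ffunE. Qed.

Lemma gratr_is_zmod_morphism : zmod_morphism gratr.
Proof. by move=> a b; apply/ffunP => x; rewrite !ffunE /gcoef !ffunE rmorphB. Qed.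

Lemma gratr_is_monoid_morphism : monoid_morphism gratr.
Proof.
split; first by apply: gringP => x; rewrite gratrE !gcoef_elt; case: eqP.
move=> a b; apply: gringP => x; rewrite gratrE !gcoefM rmorph_sum.
by apply: eq_bigr => y _; rewrite rmorphM !gratrE.
Qed.

HB.instance Definition _ := GRing.isZmodMorphism.Build _ _ gratr
  gratr_is_zmod_morphism.
HB.instance Definition _ := GRing.isMonoidMorphism.Build _ _ gratr
  gratr_is_monoid_morphism.

Definition gratr_scale (a : ZG) (x : QG) : QG := gratr a * x.

Lemma gratr_scaleA a b x :
  gratr_scale a (gratr_scale b x) = gratr_scale (a * b) x.
Proof. by rewrite /gratr_scale rmorphM mulrA. Qed.
Lemma gratr_scale1 : left_id 1 gratr_scale.
Proof. by move=> x; rewrite /gratr_scale rmorph1 mul1r. Qed.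
Lemma gratr_scaleDr : right_distributive gratr_scale +%R.
Proof. by move=> a x y; rewrite /gratr_scale mulrDr. Qed.
Lemma gratr_scaleDl x : {morph gratr_scale^~ x : a b / a + b}.
Proof. by move=> a b; rewrite /gratr_scale rmorphD mulrDl. Qed.

HB.instance Definition _ := GRing.Zmodule_isLmodule.Build ZG QG
  gratr_scaleA gratr_scale1 gratr_scaleDr gratr_scaleDl.

End RationalGroupRing.

Section Span.
Variables (R : comNzRingType) (M : lmodType R).

Definition lspan (S : set M) : set M :=
  [set x | exists n (a : 'I_n -> R) (v : 'I_n -> M),
     (forall i, S (v i)) /\ x = \sum_i a i *: v i].

Definition lspanb (S : set M) : {pred M} := fun x => `[< lspan S x >].

Lemma lspanb_closed S : zmod_closed (lspanb S).
Proof.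
split; first by apply/asboolP; exists 0%N, (fun=> 0), (fun=> 0); split;
  [case | rewrite big_ord0].
move=> x y /asboolP[m [a [v [Sv ->]]]] /asboolP[n [b [w [Sw ->]]]].
apply/asboolP; exists (m + n)%N.
exists (fun i => match split i with inl j => a j | inr j => - b j end).
exists (fun i => match split i with inl j => v j | inr j => w j end).
split=> [i|]; first by case: split.
rewrite big_split_ord -sumrN /=; congr (_ + _); apply: eq_bigr => i _.
  by rewrite (unsplitK (inl i)).
by rewrite (unsplitK (inr i)) scaleNr.
Qed.

Lemma lspanbZ S a x : x \in lspanb S -> a *: x \in lspanb S.
Proof.
move=> /asboolP[n [b [v [Sv ->]]]]; apply/asboolP.
exists n, (fun i => a * b i), v; split=> //.
by rewrite scaler_sumr; apply: eq_bigr => i _; rewrite scalerA.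
Qed.

HB.instance Definition _ S := GRing.isZmodClosed.Build M (lspanb S)
  (lspanb_closed S).

(* The quotient of M by the submodule generated by S. *)
Definition lquot (S : set M) : Type := @Quotient.quot M (lspanb S).

Section QuotientModule.
Variable S : set M.
Local Notation Q := (lquot S).

HB.instance Definition _ := GRing.Zmodule.on Q.

Definition lquot_pi (x : M) : Q := \pi_(@Quotient.quot M (lspanb S))%qT x.

Definition lquot_scale (a : R) (u : Q) : Q :=
  lquot_pi (a *: repr (u : @Quotient.quot M (lspanb S))).

Lemma lquot_piD x y : lquot_pi (x + y) = lquot_pi x + lquot_pi y.
Proof. exact: raddfD. Qed.

Lemma lquot_pi_surj u : exists x, u = lquot_pi x.
Proof. by exists (repr (u : @Quotient.quot M (lspanb S))); rewrite /lquot_pi reprK. Qed.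

Lemma lquot_piZ a x : lquot_scale a (lquot_pi x) = lquot_pi (a *: x).
Proof.
apply/eqP; rewrite /lquot_scale /lquot_pi -Quotient.idealrBE -scalerBr.
by rewrite lspanbZ // Quotient.idealrBE reprK.
Qed.

Lemma lquot_scaleA a b u :
  lquot_scale a (lquot_scale b u) = lquot_scale (a * b) u.
Proof. by have [x ->] := lquot_pi_surj u; rewrite !lquot_piZ scalerA. Qed.
Lemma lquot_scale1 : left_id 1 lquot_scale.
Proof. by move=> u; have [x ->] := lquot_pi_surj u; rewrite lquot_piZ scale1r. Qed.
Lemma lquot_scaleDr : right_distributive lquot_scale +%R.
Proof.
move=> a u v; have [x ->] := lquot_pi_surj u; have [y ->] := lquot_pi_surj v.
by rewrite -lquot_piD !lquot_piZ scalerDr lquot_piD.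
Qed.
Lemma lquot_scaleDl u : {morph lquot_scale^~ u : a b / a + b}.
Proof.
move=> a b; have [x ->] := lquot_pi_surj u.
by rewrite !lquot_piZ scalerDl lquot_piD.
Qed.

HB.instance Definition _ := GRing.Zmodule_isLmodule.Build R Q
  lquot_scaleA lquot_scale1 lquot_scaleDr lquot_scaleDl.

End QuotientModule.
End Span.

(* Restriction of scalars of M along f. *)
Definition restr (R S : comNzRingType) (f : {rmorphism R -> S})
  (M : lmodType S) : Type := M.

Section Restriction.
Variables (R S : comNzRingType) (f : {rmorphism R -> S}) (M : lmodType S).
Local Notation N := (restr f M).

HB.instance Definition _ := GRing.Zmodule.on N.

Definition restr_scale (a : R) (x : N) : N := f a *: (x : M).

Lemma restr_scaleA a b x :
  restr_scale a (restr_scale b x) = restr_scale (a * b) x.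
Proof. by rewrite /restr_scale rmorphM scalerA. Qed.
Lemma restr_scale1 : left_id 1 restr_scale.
Proof. by move=> x; rewrite /restr_scale rmorph1 scale1r. Qed.
Lemma restr_scaleDr : right_distributive restr_scale +%R.
Proof. by move=> a x y; rewrite /restr_scale scalerDr. Qed.
Lemma restr_scaleDl x : {morph restr_scale^~ x : a b / a + b}.
Proof. by move=> a b; rewrite /restr_scale rmorphD scalerDl. Qed.

HB.instance Definition _ := GRing.Zmodule_isLmodule.Build R N
  restr_scaleA restr_scale1 restr_scaleDr restr_scaleDl.

End Restriction.

Section Ideals.
Variable R : comNzRingType.

Definition ideal_gen (S : set R) : set R := @lspan R R^o S.

(* R/(g) as an R-module *)
Definition cyc_quot (g : R) : lmodType R := lquot ([set g] : set R^o).

Definition idealM (A B : set R) : set R :=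
  ideal_gen [set x | exists a b, [/\ A a, B b & x = a * b]].

Definition idealX (A : set R) (n : nat) : set R := iter n (idealM A) setT.

End Ideals.

Section Modules.
Variable R : comNzRingType.

Definition projective (M : lmodType R) : Prop :=
  forall (N N' : lmodType R) (p : {linear N -> N'}) (f : {linear M -> N'}),
    (forall y, exists x, p x = y) -> exists g : {linear M -> N}, p \o g =1 f.

Definition short_exact (M' M M'' : lmodType R)
    (i : {linear M' -> M}) (p : {linear M -> M''}) : Prop :=
  [/\ injective i, (forall z, exists y, p y = z)
    & forall y, p y = 0 <-> exists x, i x = y].

Definition pd_le1 (M : lmodType R) : Prop :=
  exists (F1 F0 : lmodType R) (d : {linear F1 -> F0}) (e : {linear F0 -> M}),
    [/\ projective F1, projective F0 & short_exact d e].

(* Generated by the maximal minors of the relations between the generators x. *)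
Definition fitt_of (M : lmodType R) (n : nat) (x : 'I_n -> M) : set R :=
  ideal_gen [set d | exists B : 'M[R]_n,
    (forall i, \sum_j B i j *: x j = 0) /\ d = \det B].

(* The Fitting ideal does not depend on the finite generating family; it is
   computed from an arbitrary one (set0 if M is not finitely generated). *)
Definition Fitt (M : lmodType R) : set R :=
  xget set0 [set J | exists n (x : 'I_n -> M),
    lspan (range x) = setT /\ J = fitt_of x].

End Modules.

Section FractionalIdeals.
Variable G : finAbGroupType.
Local Notation ZG := (gring int G).
Local Notation QG := (gring rat G).

(* The Z[G]-submodule of Q[G] generated by S. *)
Definition frac_gen (S : set QG) : set QG := @lspan ZG QG S.

Definition fracM (A B : set QG) : set QG :=
  frac_gen [set x | exists a b, [/\ A a, B b & x = a * b]].

(* The inverse (Z[G] : A) of an invertible fractional ideal A; it is a^-1 Z[G]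
   for A = a Z[G] with a invertible in Q[G]. *)
Definition fracV (A : set QG) : set QG :=
  [set x | forall a, A a -> range (@gratr G) (x * a)].

(* Fitt^[1] does not depend on the sequence 0 -> Y -> P -> X -> 0; it is
   computed from an arbitrary one. *)
Definition Fitt1 (X : lmodType ZG) : set QG :=
  xget set0 [set F | exists (Y P : lmodType ZG)
      (i : {linear Y -> P}) (p : {linear P -> X}),
    [/\ finite_set [set: Y], finite_set [set: P], pd_le1 P, short_exact i p
      & F = fracM (fracV (@gratr G @` Fitt P)) (@gratr G @` Fitt Y)]].

End FractionalIdeals.

Section Data.
Variables (G : finAbGroupType) (I D : {group G}).
Local Notation ZG := (gring int G).
Local Notation QG := (gring rat G).

Definition gA (phi : coset_of I) : gring int (coset_of I) :=
  1 - gelt int phi^-1%g + #|I|%:R.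

(* Z[G/I]/(g), as a Z[G]-module *)
Definition modA (phi : coset_of I) : lmodType ZG :=
  restr (@gproj int G I) (cyc_quot (gA phi)).

(* (nu_I / #I) * phi^-1 in Q[G], computed with the lift phit of phi *)
Definition idem_frob (phit : G) : QG :=
  gconst G (#|I|%:R^-1 : rat) * gsum rat I * gelt rat phit^-1%g.

Definition elt_h (phit : G) : QG := 1 - idem_frob phit + gsum rat I.

(* Z_i: products over the subsets L of the s indices with #L = s - i *)
Definition Zideal (s : nat) (Is : 'I_s -> {group G}) (i : nat) : set ZG :=
  ideal_gen [set x | exists L : {set 'I_s},
    #|L| = (s - i)%N /\ x = \prod_(l in L) gsum int (Is l)].

Definition aug_ker : set ZG := [set x | @gproj int G D x = 0].

Definition Jideal (s : nat) (Is : 'I_s -> {group G}) : set ZG :=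
  ideal_gen [set x | exists i,
    (1 <= i <= s)%N /\ idealM (Zideal Is i) (idealX aug_ker i.-1) x].

End Data.

(* Main.v *)
Require Import Defs.
From HB Require Import structures.
From mathcomp Require Import all_boot all_algebra all_fingroup all_solvable.
From mathcomp Require Import generic_quotient ring_quotient ring.
From mathcomp Require Import boolp classical_sets cardinality.

(* Write R = Z[G], let sg_l generate I_l, put t_l = sg_l - 1, nu_l the norm of
   I_l, and lift g to the regular element f = 1 - phit^-1 + #I of R.

   If P is finite of projective dimension at most 1, the module of relations
   between generators of P is projective of full rank.  A dual basis of it and
   the Cauchy-Binet formula show that Fitt(P) is invertible and that
   Fitt(W) = Fitt(Y) Fitt(P) for an extension W of P by Y, without localising.
   Applied to fibre products over A, this shows that Fitt^[1](A) can be computed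
   from 0 -> Y0 -> R/(f) -> A -> 0, i.e. Fitt^[1](A) = f^-1 Fitt(Y0), where Y0
   is generated by the classes of the t_l.

   The relations between these classes are the syzygies of (t_l), which are
   generated by nu_l e_l and by the Koszul relations t_l e_k - t_k e_l, together
   with f R^s.  Expanding the maximal minors, those which involve no multiple of
   f vanish except nu_I, and one gets
     Fitt(Y0) = (nu_I) + f sum_(i >= 1) Z_i (f, t_1, ..., t_s)^(i-1).
   Finally f = gam + nu_I with (gam, t_1, ..., t_s) = I_D, h nu_I = f nu_I and
   h = (1 - (nu_I / #I) phi^-1) + nu_I, so that modulo nu_I one may replace f by
   gam inside the powers and h by 1 - (nu_I / #I) phi^-1. *)

Set Implicit Arguments.
Unset Strict Implicit.
Unset Printing Implicit Defensive.

Import GRing.Theory.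
Local Open Scope classical_set_scope.
Local Open Scope ring_scope.

(** * Spans and Fitting ideals of families *)

Section Lspan.
Variables (R : comNzRingType) (M : lmodType R).
Implicit Types (S T : set M).

Lemma lspan_incl S x : S x -> lspan S x.
Proof.
move=> Sx; exists 1%N, (fun=> 1), (fun=> x); split=> //.
by rewrite big_ord1 scale1r.
Qed.

Lemma lspanbP S x : reflect (lspan S x) (x \in lspanb S).
Proof. exact: asboolP. Qed.

Lemma lspan0 S : lspan S 0.
Proof. exact/lspanbP/rpred0. Qed.

Lemma lspanD S x y : lspan S x -> lspan S y -> lspan S (x + y).
Proof. by move=> /lspanbP Sx /lspanbP Sy; apply/lspanbP/rpredD. Qed.

Lemma lspanN S x : lspan S x -> lspan S (- x).
Proof. by move=> /lspanbP Sx; apply/lspanbP; rewrite rpredN. Qed.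

Lemma lspanZ S a x : lspan S x -> lspan S (a *: x).
Proof. by move=> /lspanbP Sx; apply/lspanbP/lspanbZ. Qed.

Lemma lspan_sum S (J : Type) (r : seq J) (P : pred J) (F : J -> M) :
  (forall j, P j -> lspan S (F j)) -> lspan S (\sum_(j <- r | P j) F j).
Proof.
by move=> SF; apply: (big_ind (lspan S)) => //; [exact: lspan0|exact: lspanD].
Qed.

Lemma lspan_ind (Q : M -> Prop) S :
  Q 0 -> (forall a x y, S x -> Q y -> Q (a *: x + y)) ->
  forall x, lspan S x -> Q x.
Proof.
move=> Q0 QD x [n [a [v [Sv ->]]]]; elim/big_rec: _ => //= i y _ Qy.
exact: QD.
Qed.

Lemma lspan_sub S T : S `<=` lspan T -> lspan S `<=` lspan T.
Proof.
move=> ST; apply: lspan_ind; first exact: lspan0.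
by move=> a x y Sx Ty; apply: lspanD => //; apply/lspanZ/ST.
Qed.

Lemma lspan_rangeP n (x : 'I_n -> M) v :
  lspan (range x) v <-> exists c : 'I_n -> R, v = \sum_j c j *: x j.
Proof.
split=> [|[c ->]]; last first.
  by apply: lspan_sum => j _; apply/lspanZ/lspan_incl; exists j.
move: v; apply: lspan_ind.
  by exists (fun=> 0); rewrite big1 // => j _; rewrite scale0r.
move=> a _ _ [j _ <-] [c ->]; exists (fun i => (i == j)%:R * a + c i).
under [RHS]eq_bigr => i _ do rewrite scalerDl.
rewrite big_split /=; congr (_ + _).
rewrite (bigD1 j) //= eqxx mul1r big1 ?addr0 // => i /negbTE->.
by rewrite mul0r scale0r.
Qed.

End Lspan.

Section IdealGen.
Variable R : comNzRingType.
Implicit Types (S T : set R).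

Lemma ideal_gen_incl S x : S x -> ideal_gen S x.
Proof. exact: (@lspan_incl _ R^o). Qed.

Lemma ideal_gen0 S : ideal_gen S 0.
Proof. exact: (@lspan0 _ R^o). Qed.

Lemma ideal_genD S x y : ideal_gen S x -> ideal_gen S y -> ideal_gen S (x + y).
Proof. exact: (@lspanD _ R^o). Qed.

Lemma ideal_genN S x : ideal_gen S x -> ideal_gen S (- x).
Proof. exact: (@lspanN _ R^o). Qed.

Lemma ideal_genMl S a x : ideal_gen S x -> ideal_gen S (a * x).
Proof. exact: (@lspanZ _ R^o). Qed.

Lemma ideal_genMr S a x : ideal_gen S x -> ideal_gen S (x * a).
Proof. by rewrite mulrC; apply: ideal_genMl. Qed.

Lemma ideal_gen_sum S (J : Type) (r : seq J) (P : pred J) (F : J -> R) :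
  (forall j, P j -> ideal_gen S (F j)) ->
  ideal_gen S (\sum_(j <- r | P j) F j).
Proof. exact: (@lspan_sum _ R^o). Qed.

Lemma ideal_gen_ind (Q : R -> Prop) S :
  Q 0 -> (forall a x y, S x -> Q y -> Q (a * x + y)) ->
  forall x, ideal_gen S x -> Q x.
Proof. exact: (@lspan_ind _ R^o). Qed.

Lemma ideal_gen_sub S T : S `<=` ideal_gen T -> ideal_gen S `<=` ideal_gen T.
Proof. exact: (@lspan_sub _ R^o). Qed.

Lemma idealM_incl (A B : set R) a b : A a -> B b -> idealM A B (a * b).
Proof. by move=> Aa Bb; apply: ideal_gen_incl; exists a, b. Qed.

Lemma idealX_prod (A : set R) (J : Type) (r : seq J) (F : J -> R) :
  (forall j, A (F j)) -> idealX A (size r) (\prod_(j <- r) F j).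
Proof.
move=> AF; elim: r => [|j r IHr] //=.
by rewrite big_cons; apply: idealM_incl.
Qed.

End IdealGen.

(** * Independence of the generating family *)

Section FittingFamilies.
Variable R : comNzRingType.

Definition fcat (M : Type) m n (x : 'I_m -> M) (y : 'I_n -> M)
    (i : 'I_(m + n)) : M :=
  match split i with inl j => x j | inr j => y j end.

Lemma fcat_lshift (M : Type) m n (x : 'I_m -> M) (y : 'I_n -> M) j :
  fcat x y (lshift n j) = x j.
Proof. by rewrite /fcat (unsplitK (inl j)). Qed.

Lemma fcat_rshift (M : Type) m n (x : 'I_m -> M) (y : 'I_n -> M) j :
  fcat x y (rshift m j) = y j.
Proof. by rewrite /fcat (unsplitK (inr j)). Qed.

Variable M : lmodType R.

Lemma fcat_sum m n (x : 'I_m -> M) (y : 'I_n -> M) (b : 'I_(m + n) -> R) :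
  \sum_i b i *: fcat x y i =
  \sum_i b (lshift n i) *: x i + \sum_i b (rshift m i) *: y i.
Proof.
rewrite big_split_ord /=.
by congr (_ + _); apply: eq_bigr => i _; rewrite ?fcat_lshift ?fcat_rshift.
Qed.

Lemma fitt_of_incl n (x : 'I_n -> M) (B : 'M[R]_n) :
  (forall i, \sum_j B i j *: x j = 0) -> fitt_of x (\det B).
Proof. by move=> Bx; apply: ideal_gen_incl; exists B. Qed.

(** Deleting the column of the zero generator from a relation leaves a relation between the other
    generators, so the cofactors along that column are, up to sign, minors for the smaller
    family. *)
Lemma fitt_of_col0 n (x : 'I_n.+1 -> M) :
  x ord0 = 0 -> fitt_of x `<=` fitt_of (x \o lift ord0).
Proof.
move=> x0; apply: ideal_gen_sub => _ [B [Bx ->]].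
rewrite (expand_det_col _ ord0); apply: ideal_gen_sum => i _.
apply/ideal_genMl/ideal_genMl/ideal_gen_incl.
exists (row' i (col' ord0 B)); split=> // k.
have := Bx (lift i k); rewrite big_ord_recl x0 scaler0 add0r => E; rewrite -[RHS]E.
by apply: eq_bigr => j _; rewrite !mxE.
Qed.

(** If the rows of [B] are relations for [x], those of [B *m U] are relations for [y], with the same
    determinant. *)
Lemma fitt_of_shear n (x y : 'I_n -> M) (U : 'M[R]_n) :
  \det U = 1 -> (forall i, x i = \sum_j U i j *: y j) ->
  fitt_of x `<=` fitt_of y.
Proof.
move=> detU xy; apply: ideal_gen_sub => _ [B [Bx ->]].
rewrite -[\det B]mulr1 -detU -det_mulmx; apply: fitt_of_incl => i.
rewrite -[RHS](Bx i).
under eq_bigr => j _ do rewrite mxE scaler_suml.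
rewrite exchange_big /=; apply: eq_bigr => k _.
by rewrite xy scaler_sumr; apply: eq_bigr => j _; rewrite scalerA.
Qed.

(** A shear replaces the redundant generator by 0. Conversely, the relation expressing it is
    adjoined as a first row with leading entry 1. *)
Lemma fitt_of_cons n (x : 'I_n.+1 -> M) :
  lspan (range (x \o lift ord0)) (x ord0) ->
  fitt_of x = fitt_of (x \o lift ord0).
Proof.
move=> /lspan_rangeP[c xc].
have e0 : lshift n (0 : 'I_1) = ord0 :> 'I_n.+1 by apply: val_inj.
have eS (k : 'I_n) : rshift 1 k = lift ord0 k :> 'I_n.+1 by apply: val_inj.
apply/seteqP; split.
  pose y (i : 'I_n.+1) := if i == ord0 then 0 else x i.
  pose U : 'M[R]_(1 + n) := block_mx 1%:M (\row_(j < n) c j) 0 1%:M.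
  have -> : x \o lift ord0 = y \o lift ord0 by [].
  have xy : fitt_of x `<=` fitt_of y.
    apply: (@fitt_of_shear _ _ _ U); first by rewrite det_ublock !det1 mulr1.
    move=> i; rewrite (@big_split_ord _ _ _ 1 n) big_ord1 /=.
    rewrite e0 {1}/y eqxx scaler0 add0r; case: (@split_ordP 1 n i) => j ->.
      rewrite (ord1 j) e0 xc; apply: eq_bigr => k _.
      by rewrite -e0 /U (@block_mxEur _ 1 n 1 n) mxE eS.
    rewrite (bigD1 j) //= big1 => [|k kj]; rewrite /U (@block_mxEdr _ 1 n 1 n) mxE.
      by rewrite eqxx scale1r addr0.
    by rewrite eq_sym (negbTE kj) scale0r.
  by apply: subset_trans xy _; apply: fitt_of_col0; rewrite /y eqxx.
apply: ideal_gen_sub => _ [A [Ax ->]].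
pose B : 'M[R]_(1 + n) := @block_mx _ 1 n 1 n 1%:M (- \row_(j < n) c j) 0 A.
have -> : \det A = \det B by rewrite det_ublock det1 mul1r.
apply: fitt_of_incl => i; rewrite (@big_split_ord _ _ _ 1 n) big_ord1 /=.
rewrite e0; case: (@split_ordP 1 n i) => j ->.
  have -> : B (lshift n j) ord0 = 1.
    by rewrite -e0 /B (@block_mxEul _ 1 n 1 n) mxE (ord1 j) eqxx.
  rewrite /B scale1r xc -big_split big1 //=.
  by move=> k _; rewrite (@block_mxEur _ 1 n 1 n) !mxE eS -scalerDl subrr scale0r.
rewrite -{1}e0 /B (@block_mxEdl _ 1 n 1 n) mxE scale0r add0r -[RHS](Ax j).
by apply: eq_bigr => k _; rewrite (@block_mxEdr _ 1 n 1 n) eS.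
Qed.

Lemma fitt_of_fcat m n (y : 'I_m -> M) (x : 'I_n -> M) :
  (forall j, lspan (range x) (y j)) -> fitt_of (fcat y x) = fitt_of x.
Proof.
elim: m y => [|m IHm] y xy.
  rewrite (_ : fcat y x = x) //; apply: funext => i.
  by rewrite -[in LHS](_ : rshift 0 i = i) ?fcat_rshift //; apply: val_inj.
have E : (fcat y x : 'I_(m + n).+1 -> M) \o lift ord0 =
         fcat (y \o lift ord0) x.
  apply: funext => i; case: (splitP i) => j ij /=.
    have -> : i = lshift n j by apply: val_inj.
    rewrite fcat_lshift (_ : lift _ _ = lshift n (lift ord0 j)) ?fcat_lshift //.
    exact: val_inj.
  have -> : i = rshift m j by apply: val_inj.
  rewrite fcat_rshift (_ : lift _ _ = rshift m.+1 j) ?fcat_rshift //.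
  exact: val_inj.
rewrite fitt_of_cons E ?IHm // => [j|]; first exact: xy.
rewrite (_ : (ord0 : 'I_(m + n).+1) = lshift n (ord0 : 'I_m.+1)); last exact: val_inj.
rewrite fcat_lshift; move: (xy ord0); apply: lspan_sub => _ [j _ <-].
by apply: lspan_incl; exists (rshift m j); rewrite ?fcat_rshift.
Qed.

(** Renumbering the generators permutes the columns and changes the determinant by a sign. The
    equality [m = n] is a separate hypothesis because it will be the commutativity of addition,
    which is not a conversion. *)
Lemma fitt_of_bij m n (x : 'I_m -> M) (f : 'I_n -> 'I_m) :
  m = n -> bijective f -> fitt_of (x \o f) `<=` fitt_of x.
Proof.
move=> emn; case: _ / emn f => f /bij_inj f_inj.
apply: ideal_gen_sub => _ [B [Bx ->]].
pose s := perm f_inj.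
have -> : \det B = (-1) ^+ s * \det (col_perm s^-1 B).
  by rewrite col_permE det_mulmx det_perm invgK mulrCA -expr2 sqrr_sign mulr1.
apply/ideal_genMl/fitt_of_incl => i; rewrite -[RHS](Bx i).
rewrite (reindex_inj f_inj); apply: eq_bigr => j _ /=.
by rewrite mxE -[f j](permE f_inj) permK.
Qed.

(** Adjoining redundant generators does not change the ideal, so both ideals are that of the
    concatenated family, up to the order of concatenation. *)
Lemma fitt_of_span m n (x : 'I_m -> M) (y : 'I_n -> M) :
  (forall i, lspan (range y) (x i)) -> (forall j, lspan (range x) (y j)) ->
  fitt_of x = fitt_of y.
Proof.
suff sub k l (u : 'I_k -> M) (v : 'I_l -> M) :
    (forall i, lspan (range v) (u i)) -> (forall j, lspan (range u) (v j)) ->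
    fitt_of u `<=` fitt_of v.
  by move=> xy yx; apply/seteqP; split; apply: sub.
move=> uv vu; rewrite -(fitt_of_fcat vu) -(fitt_of_fcat uv).
pose f (i : 'I_(l + k)) : 'I_(k + l) :=
  match split i with inl j => rshift k j | inr j => lshift l j end.
pose g (i : 'I_(k + l)) : 'I_(l + k) :=
  match split i with inl j => rshift l j | inr j => lshift k j end.
have -> : fcat v u = fcat u v \o f.
  apply: funext => i; rewrite /f /=; rewrite {1}/fcat.
  by case: split => j; rewrite ?fcat_rshift ?fcat_lshift.
apply: fitt_of_bij; first exact: addnC.
exists g => i; rewrite /f /g.
  by case: (split_ordP i) => j ->;
    rewrite ?(unsplitK (inl _)) ?(unsplitK (inr _)).
by case: (split_ordP i) => j ->;
  rewrite ?(unsplitK (inl _)) ?(unsplitK (inr _)).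
Qed.

(** By [fitt_of_span] all candidates for [xget] coincide, and the given family shows that there is
    one. *)
Lemma FittE n (x : 'I_n -> M) : lspan (range x) = setT -> Fitt M = fitt_of x.
Proof.
move=> xT; rewrite /Fitt; case: xgetP => [J _ [m [y [yT ->]]]|/(_ (fitt_of x))].
  by apply: fitt_of_span => i; rewrite ?xT ?yT.
by case; exists n, x.
Qed.

Lemma finite_generators : finite_set [set: M] ->
  exists n (x : 'I_n -> M), lspan (range x) = setT.
Proof.
case/finite_seqP => r rE; exists (size r), (fun i => nth 0 r i).
apply/seteqP; split=> // v _; apply: lspan_incl.
have vr : v \in r by have : [set: M] v by []; rewrite rE.
rewrite -index_mem in vr; exists (Ordinal vr) => //=.
by rewrite nth_index // -index_mem.
Qed.

End FittingFamilies.

(** * Invertibility and multiplicativity *)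

Section CauchyBinet.
Variable R : comNzRingType.

Lemma det_mulmx_rowsub m n (A : 'M[R]_(n, m)) (B : 'M[R]_(m, n)) :
  \det (A *m B) =
  \sum_(f : {ffun 'I_n -> 'I_m}) (\prod_i A i (f i)) * \det (rowsub f B).
Proof.
rewrite /determinant.
under eq_bigr => s _.
  under eq_bigr => i _ do rewrite mxE.
  rewrite bigA_distr_bigA mulr_sumr /=.
  over.
rewrite exchange_big /=; apply: eq_bigr => f _.
rewrite mulr_sumr; apply: eq_bigr => s _.
rewrite big_split /= mulrCA; congr (_ * (_ * _)).
by apply: eq_bigr => i _; rewrite mxE.
Qed.

Lemma det_rowsub_perm m n (B : 'M[R]_(m, n)) (f : 'I_n -> 'I_m) (s : 'S_n) :
  \det (rowsub (f \o s) B) = (-1) ^+ s * \det (rowsub f B).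
Proof.
rewrite (_ : rowsub _ _ = row_perm s (rowsub f B)).
  by rewrite row_permE det_mulmx det_perm.
by apply/matrixP => i j; rewrite !mxE.
Qed.

(** In the multilinear expansion over all maps, the non-injective ones give a repeated row, and
    those with the same image differ by a permutation, whose signs collect into the minor of [A].
    The list [s] contains one enumeration of each subset of [n] indices; as the choice of
    enumeration is immaterial, [s] is left unspecified. *)
Lemma Cauchy_Binet m n (A : 'M[R]_(n, m)) (B : 'M[R]_(m, n)) :
  exists s : seq {ffun 'I_n -> 'I_m}, \det (A *m B) =
    \sum_(f <- s) \det (colsub f A) * \det (rowsub f B).
Proof.
pose T (f : {ffun 'I_n -> 'I_m}) := (\prod_i A i (f i)) * \det (rowsub f B).
have fiber (f0 : {ffun 'I_n -> 'I_m}) : injective f0 ->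
    \sum_(f : {ffun 'I_n -> 'I_m} |
        injectiveb f && ([set f i | i : 'I_n]%SET == [set f0 i | i : 'I_n]%SET)) T f =
    \det (colsub f0 A) * \det (rowsub f0 B).
  move=> f0_inj; pose h (s : 'S_n) := [ffun i => f0 (s i)].
  have h_inj : injective h.
    move=> s t /ffunP st; apply/permP => i; apply: f0_inj.
    by have := st i; rewrite !ffunE.
  rewrite (eq_bigl (mem (h @: [set: 'S_n])%SET)) => [|f /=]; last first.
    apply/andP/imsetP => [[/injectiveP f_inj /eqP imf]|[s _ ->]].
      have /fin_all_exists[t tE] i : exists j, f i = f0 j.
        have : f i \in [set f i | i : 'I_n]%SET by apply: imset_f.
        by rewrite imf => /imsetP[j _ ->]; exists j.
      have t_inj : injective t by move=> i j tij; apply: f_inj; rewrite !tE tij.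
      by exists (perm t_inj); rewrite ?inE //; apply/ffunP => i; rewrite ffunE permE.
    split; first by apply/injectiveP => i j; rewrite !ffunE => /f0_inj/perm_inj.
    apply/eqP/setP => k; apply/imsetP/imsetP => -[i _ ->].
      by exists (s i); rewrite ?ffunE.
    by exists (s^-1 i)%g; rewrite ?ffunE ?permKV.
  rewrite big_imset /=; last by move=> s t _ _; apply: h_inj.
  rewrite /determinant mulr_suml; apply: eq_big => [s|s _]; first by rewrite inE.
  rewrite /T (_ : rowsub (h s) B = rowsub (f0 \o s) B); last first.
    by apply/matrixP => i j; rewrite !mxE ffunE.
  rewrite det_rowsub_perm mulrA; congr (_ * _); rewrite mulrC; congr (_ * _).
  by apply: eq_bigr => i _; rewrite mxE ffunE.
(* Subsets of the wrong size yield [None] and drop out of [pmap]. *)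
pose pk (S : {set 'I_m}) :=
  [pick f : {ffun 'I_n -> 'I_m} | injectiveb f & [set f i | i : 'I_n]%SET == S].
exists (pmap pk (index_enum _)).
rewrite det_mulmx_rowsub (bigID (fun f : {ffun 'I_n -> 'I_m} => injectiveb f)) /=.
rewrite [X in _ + X]big1 ?addr0 => [|f /injectivePn[i [j ij fij]]]; last first.
  rewrite (@determinant_alternate _ _ _ i j) ?mulr0 // => k.
  by rewrite !mxE fij.
rewrite (partition_big
  (fun f : {ffun 'I_n -> 'I_m} => [set f i | i : 'I_n]%SET) predT) //=.
rewrite big_pmap /=; apply: eq_bigr => S _; rewrite /pk; case: pickP => [f0|none] /=.
  by case/andP=> /injectiveP f0_inj /eqP <-; apply: fiber.
by rewrite big_pred0.
Qed.

End CauchyBinet.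

Section DualBasis.
Variables (R S : comNzRingType) (f : {rmorphism R -> S}).

(* [k] generates the module K of relations between the [w j], and [Phi]
   represents, after the extension of scalars [f], coordinate forms of a dual
   basis of K for these generators: K is projective. *)
Definition dual_basis (P : lmodType R) m n (w : 'I_n -> P)
    (k : 'M[R]_(m, n)) (Phi : 'M[S]_(n, m)) : Prop :=
  [/\ forall i, \sum_j k i j *: w j = 0,
      forall b : 'rV[R]_n, \sum_j b 0 j *: w j = 0 ->
        exists2 c : 'rV[R]_m, b = c *m k & map_mx f c = map_mx f b *m Phi
    & Phi *m map_mx f k = 1%:M].

(** Cauchy-Binet for the dual basis identity. The minors of [k] lie in the Fitting ideal and, over
    Z[G], those of [Phi] will be seen to lie in its inverse: this is the invertibility of
    Fitt(P). *)
Lemma dual_basis_minors (P : lmodType R) m n (w : 'I_n -> P)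
    (k : 'M[R]_(m, n)) (Phi : 'M[S]_(n, m)) : dual_basis w k Phi ->
  exists s : seq {ffun 'I_n -> 'I_m},
    \sum_(t <- s) \det (colsub t Phi) * f (\det (rowsub t k)) = 1.
Proof.
case=> _ _ Pk; have [s] := Cauchy_Binet Phi (map_mx f k).
rewrite Pk det1 => ->; exists s; apply: eq_bigr => t _.
by rewrite -det_map_mx; congr (_ * \det _); apply/matrixP => i j; rewrite !mxE.
Qed.

Lemma fitt_of_rowsub (P : lmodType R) m n (w : 'I_n -> P)
    (k : 'M[R]_(m, n)) (Phi : 'M[S]_(n, m)) t :
  dual_basis w k Phi -> fitt_of w (\det (rowsub t k)).
Proof.
case=> kw _ _; apply: fitt_of_incl => i; rewrite -[RHS](kw (t i)).
by apply: eq_bigr => j _; rewrite mxE.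
Qed.

(** * Fitting ideals in extensions *)

Variables (M P : lmodType R) (q : {linear M -> P}).
Variables (l n : nat) (x : 'I_l -> M) (z : 'I_n -> M).
Hypothesis qx : forall i, q (x i) = 0.
Hypothesis zx : forall b : 'I_n -> R, \sum_j b j *: q (z j) = 0 ->
  lspan (range x) (\sum_j b j *: z j).

Lemma lift_relations m (k : 'M[R]_(m, n)) :
  (forall i, \sum_j k i j *: q (z j) = 0) ->
  exists C : 'M[R]_(m, l),
    forall i, \sum_j k i j *: z j = \sum_j C i j *: x j.
Proof.
move=> kz; have /fin_all_exists[c cE] i : exists c : 'I_l -> R,
    \sum_j k i j *: z j = \sum_j c j *: x j.
  by apply/lspan_rangeP/zx/kz.
by exists (\matrix_(i, j) c i j) => i; rewrite cE; apply: eq_bigr => j _; rewrite mxE.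
Qed.

(** A relation matrix for [q \o z] lifts to relations involving [x]; together with a relation matrix
    for [x] it forms a block triangular matrix. *)
Lemma fitt_of_extM a b : fitt_of x a -> fitt_of (q \o z) b ->
  fitt_of (fcat z x) (a * b).
Proof.
move=> xa; move: b; apply: ideal_gen_ind; first by rewrite mulr0; apply: ideal_gen0.
move=> r _ y [B [Bz ->]] IHy; rewrite mulrDr; apply: ideal_genD => //.
rewrite mulrCA; apply: ideal_genMl; move: a xa {IHy}; apply: ideal_gen_ind.
  by rewrite mul0r; apply: ideal_gen0.
move=> {}r _ {}y [A [Ax ->]] IHy; rewrite mulrDl; apply: ideal_genD => //.
rewrite -mulrA; apply: ideal_genMl; have [C BC] := lift_relations Bz.
rewrite mulrC -(det_ublock B (- C) A); apply: fitt_of_incl => i.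
rewrite fcat_sum; case: (split_ordP i) => j ->.
  under eq_bigr => i' _ do rewrite block_mxEul.
  rewrite BC -big_split big1 //= => i' _.
  by rewrite block_mxEur mxE -scalerDl subrr scale0r.
rewrite big1 ?add0r => [|i' _]; last by rewrite block_mxEdl mxE scale0r.
by rewrite -[RHS](Ax j); apply: eq_bigr => i' _; rewrite block_mxEdr.
Qed.

(** The inclusion opposite to [fitt_of_extM], minors of [Phi] standing for the inverse of Fitt(P).
    The left part of a relation matrix [B] consists of relations in [P], hence equals [c *m k];
    lifting [k] turns the rows of [B] into relations between the [x] alone. *)
Lemma fitt_of_ext_minor m (k : 'M[R]_(m, n)) (Phi : 'M[S]_(n, m)) t c :
  dual_basis (q \o z) k Phi -> fitt_of (fcat z x) c ->
  exists2 d, fitt_of x d & \det (colsub t Phi) * f c = f d.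
Proof.
case=> kz dual _; have [C kC] := lift_relations kz.
move: c; apply: ideal_gen_ind.
  by exists 0; rewrite ?rmorph0 ?mulr0 //; apply: ideal_gen0.
move=> r _ y [B [Bz ->]] [d xd dE].
have rel i : \sum_j B i (lshift l j) *: q (z j) = 0.
  have := congr1 q (Bz i); rewrite fcat_sum linear0 linearD !linear_sum /=.
  rewrite [X in _ + X = _ -> _]big1 ?addr0 => [E|j _].
    by rewrite -[RHS]E; apply: eq_bigr => j _; rewrite linearZZ.
  by rewrite linearZZ qx scaler0.
have /fin_all_exists2[c cE cf] i : exists2 c : 'rV[R]_m,
    lsubmx (row i B) = c *m k & map_mx f c = map_mx f (lsubmx (row i B)) *m Phi.
  by apply: dual; rewrite -[RHS](rel i); apply: eq_bigr => j _; rewrite !mxE.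
(* Over [S] this is the product of [B] by the matrix [U] below; its entries come from [R] because
   [Phi] sends relations to their coordinates. Its left columns are paired with [n] zero generators,
   which are redundant. *)
pose B' : 'M[R]_(n + l) := row_mx (\matrix_(i, j) c i 0 (t j))
  (\matrix_(i, j) ((c i *m C) 0 j + B i (rshift n j))).
have B'x : fitt_of x (\det B').
  rewrite -(@fitt_of_fcat _ _ n l (fun=> 0) x) => [|j]; last exact: lspan0.
  apply: fitt_of_incl => i; rewrite fcat_sum big1 ?add0r => [|j _]; last first.
    by rewrite scaler0.
  under eq_bigr => j _ do rewrite row_mxEr mxE scalerDl.
  rewrite big_split /= -[RHS](Bz i) fcat_sum; congr (_ + _).
  transitivity (\sum_j (c i *m k) 0 j *: z j); last first.
    by rewrite -cE; apply: eq_bigr => j _; rewrite !mxE.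
  under eq_bigr => j _ do rewrite mxE scaler_suml.
  under [RHS]eq_bigr => j _ do rewrite mxE scaler_suml.
  rewrite exchange_big [RHS]exchange_big /=; apply: eq_bigr => j _.
  under eq_bigr => j' _ do rewrite -scalerA.
  under [RHS]eq_bigr => j' _ do rewrite -scalerA.
  by rewrite -!scaler_sumr kC.
exists (r * \det B' + d).
  by apply: ideal_genD => //; apply: ideal_genMl.
rewrite !rmorphD !rmorphM /= mulrDr dE; congr (_ + _); rewrite mulrCA; congr (_ * _).
rewrite -!det_map_mx; pose U : 'M[S]_(n + l) :=
  block_mx (colsub t Phi) (Phi *m map_mx f C) 0 1%:M.
have <- : \det U = \det (colsub t Phi) by rewrite det_ublock det1 mulr1.
rewrite mulrC -det_mulmx; congr (\det _); apply/row_matrixP => i.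
have E : row i (map_mx f B) =
    row_mx (map_mx f (lsubmx (row i B))) (map_mx f (rsubmx (row i B))).
  by rewrite -map_row_mx hsubmxK; apply/rowP => j; rewrite !mxE.
rewrite row_mul E mul_row_block mulmx0 mulmx1 mulmxA -cf -map_mxM /=.
rewrite addr0.
apply/rowP => j; case: (split_ordP j) => j' ->.
  rewrite row_mxEl [RHS]mxE [RHS]mxE /B' row_mxEl [in RHS]mxE.
  have := congr1 (fun M0 : 'rV_m => M0 0 (t j')) (cf i).
  by rewrite !mxE => ->; apply: eq_bigr => i' _; rewrite !mxE.
rewrite row_mxEr [RHS]mxE [RHS]mxE /B' row_mxEr [in RHS]mxE rmorphD /=.
by rewrite !mxE.
Qed.

End DualBasis.

(** * Modules of projective dimension at most one *)

Section Submodule.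
Variables (R : comNzRingType) (M : lmodType R) (S : set M).

Lemma lspanb_scale : GRing.scaler_closed (lspanb S).
Proof. by move=> a x; apply: lspanbZ. Qed.

HB.instance Definition _ := GRing.isScaleClosed.Build R M (lspanb S)
  lspanb_scale.

(** The span of [S] as a module in its own right. It serves for the relations between generators and
    for the kernel of the map from Z[G]/(f) to A. *)
Record lsub := LSub { lsub_val : M; lsub_valP : lsub_val \in lspanb S }.

HB.instance Definition _ := [isSub for lsub_val].
HB.instance Definition _ := [Choice of lsub by <:].
HB.instance Definition _ := [SubChoice_isSubLmodule of lsub by <:].

Variables (F : lmodType R) (h : {linear F -> M}).
Hypothesis hS : forall x, h x \in lspanb S.

Definition lcorestr (x : F) : lsub := LSub (hS x).

Lemma lcorestr_linear : linear lcorestr.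
Proof. by move=> a x y; apply: val_inj; rewrite /= linearP. Qed.

HB.instance Definition _ := GRing.isLinear.Build R F lsub *:%R lcorestr
  lcorestr_linear.

End Submodule.

Section FreeModules.
Variables (R : comNzRingType) (M : lmodType R) (n : nat) (x : 'I_n -> M).

Definition rowcomb (v : 'rV[R]_n) : M := \sum_j v 0 j *: x j.

Lemma rowcomb_linear : linear rowcomb.
Proof.
move=> a u v; rewrite /rowcomb scaler_sumr -big_split; apply: eq_bigr => j _.
by rewrite !mxE scalerDl scalerA.
Qed.

HB.instance Definition _ := GRing.isLinear.Build R _ M *:%R rowcomb
  rowcomb_linear.

Lemma rowcomb_delta j : rowcomb (delta_mx 0 j) = x j.
Proof.
rewrite /rowcomb (bigD1 j) //= big1 => [|i ij]; rewrite mxE eqxx /=.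
  by rewrite eqxx scale1r addr0.
by rewrite (negbTE ij) scale0r.
Qed.

End FreeModules.

Lemma row_projective (R : comNzRingType) n : projective ('rV[R]_n : lmodType R).
Proof.
move=> N N' p f p_surj.
have /fin_all_exists[y yE] j : exists y, p y = f (delta_mx 0 j) by apply: p_surj.
exists (rowcomb y) => v /=; rewrite linear_sum [in RHS](row_sum_delta v) linear_sum.
by apply: eq_bigr => j _; rewrite !linearZZ yE.
Qed.

(** * Relations and dual bases over Z[G] *)

Section GroupRingFacts.
Variable G : finAbGroupType.
Local Notation ZG := (gring int G).
Local Notation QG := (gring rat G).

Lemma gcoef_sum (R : comNzRingType) (J : Type) (r : seq J) (P : pred J)
    (F : J -> gring R G) x :
  gcoef (\sum_(j <- r | P j) F j) x = \sum_(j <- r | P j) gcoef (F j) x.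
Proof.
by elim/big_rec2: _ => [|j a b _ <-]; rewrite ?gcoefD // /gcoef ffunE.
Qed.

Lemma gcoef_natmul (R : comNzRingType) n (a : gring R G) x :
  gcoef (n%:R * a) x = n%:R * gcoef a x.
Proof.
rewrite !mulr_natl; elim: n => [|n IHn]; last by rewrite !mulrS gcoefD IHn.
by rewrite !mulr0n /gcoef ffunE.
Qed.

Lemma gcoef_constM (R : comNzRingType) c (a : gring R G) x :
  gcoef (gconst G c * a) x = c * gcoef a x.
Proof.
rewrite gcoefM (bigD1 1%g) //= big1 => [|y /negbTE ny].
  by rewrite {1}/gcoef ffunE eqxx invg1 mul1g addr0.
by rewrite {1}/gcoef ffunE ny mul0r.
Qed.

Lemma gconst_natV n : (0 < n)%N -> gconst G (n%:R^-1 : rat) * n%:R = 1.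
Proof.
move=> n0; apply: gringP => x; rewrite gcoef_constM -[X in gcoef X]mulr1 gcoef_natmul.
by rewrite mulKf // Num.Theory.pnatr_eq0 -lt0n.
Qed.

Lemma gratr_inj : injective (@gratr G).
Proof.
move=> a b ab; apply: gringP => x; apply/eqP; have := congr1 (fun c => gcoef c x) ab.
by rewrite !gratrE => /eqP; rewrite eqr_int.
Qed.

Lemma finite_torsion (R : pzRingType) (P : lmodType R) (w : P) :
  finite_set [set: P] -> exists2 N, (0 < N)%N & w *+ N = 0.
Proof.
move=> Pfin; apply: contrapT => no.
suff inj : injective (fun k => w *+ k).
  apply: infinite_nat; rewrite (_ : setT = (fun k => w *+ k) @^-1` setT) //.
  by apply: finite_preimage => // k l _ _; apply: inj.
have lt k l : (k < l)%N -> w *+ k <> w *+ l.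
  move=> kl E; apply: no; exists (l - k)%N; first by rewrite subn_gt0.
  by rewrite mulrnBr 1?ltnW // E subrr.
by move=> k l E; case: (ltngtP k l) => // /lt; rewrite E.
Qed.

(** Representatives of Z[G] modulo [N], indexed by a finite type. *)
Definition gresidue N (t : {ffun G -> 'I_N}) : ZG :=
  [ffun x => (t x : nat)%:Z] : {ffun G -> int}.

Lemma gresidue_decomp N (a : ZG) : (0 < N)%N ->
  exists (t : {ffun G -> 'I_N}) (b : ZG), a = gresidue t + N%:R * b.
Proof.
move=> N0.
exists [ffun x => Ordinal (ltn_pmod `|(gcoef a x %% N)%Z|%N N0)].
exists ([ffun x => (gcoef a x %/ N)%Z] : {ffun G -> int}).
apply: gringP => x; rewrite gcoefD gcoef_natmul /gcoef !ffunE /= natz.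
rewrite addrC mulrC -/(gcoef _ _) {1}[gcoef a x](divz_eq _ N); congr (_ + _).
set r := (_ %% _)%Z.
have r0 : 0 <= r by rewrite modz_ge0 // -lt0n.
have rN : r < N by rewrite ltz_pmod.
by rewrite modn_small ?gez0_abs // -ltz_nat gez0_abs.
Qed.

(** Modulo [N] there are only finitely many rows, so the relations are generated by those with
    reduced coefficients and by [N] times the basis vectors. *)
Lemma relations_fg (P : lmodType ZG) n (w : 'I_n -> P) N : (0 < N)%N ->
  (forall j, w j *+ N = 0) -> exists m (k : 'M[ZG]_(m, n)),
    (forall i, \sum_j k i j *: w j = 0) /\
    (forall b : 'rV[ZG]_n, \sum_j b 0 j *: w j = 0 ->
       exists c : 'rV[ZG]_m, b = c *m k).
Proof.
move=> N0 Nw; pose T := {ffun 'I_n -> {ffun G -> 'I_N}}.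
pose bt (t : T) : 'rV[ZG]_n := \row_j gresidue (t j).
(* A reduced row that is not a relation is replaced by 0, so that the index type stays
   [T + 'I_n]. *)
pose kk (i : (T + 'I_n)%type) : 'rV[ZG]_n := match i with
  | inl t => if rowcomb w (bt t) == 0 then bt t else 0
  | inr j => N%:R *: delta_mx 0 j end.
pose k := \matrix_(i < #|{: T + 'I_n}|) kk (enum_val i).
exists #|{: T + 'I_n}|, k.
have Nw0 (u : 'rV[ZG]_n) : rowcomb w (N%:R *: u) = 0.
  rewrite linearZZ /rowcomb scaler_sumr big1 // => j _.
  by rewrite scalerA mulrC -scalerA scaler_nat Nw scaler0.
have kw i : rowcomb w (kk i) = 0.
  case: i => [t|j] /=; last exact: Nw0.
  by case: eqP => // _; rewrite linear0.
split=> [i|b bw].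
  rewrite -[RHS](kw (enum_val i)); apply: eq_bigr => j _.
  by rewrite [k _ _]mxE.
have kin i : exists c, kk i = c *m k.
  by exists (delta_mx 0 (enum_rank i)); rewrite -rowE rowK enum_rankK.
have /fin_all_exists[tb /fin_all_exists[qb tqE]] j := gresidue_decomp (b 0 j) N0.
pose t : T := [ffun j => tb j]; pose b' : 'rV[ZG]_n := \row_j qb j.
have bE : b = bt t + N%:R *: b'.
  by apply/rowP => j; rewrite !mxE ffunE.
have btw : rowcomb w (bt t) = 0.
  have : rowcomb w b = 0 by [].
  by rewrite bE linearD /= Nw0 addr0.
have [c cE] := kin (inl t); rewrite /= btw eqxx in cE.
have /fin_all_exists[d dE] j := kin (inr j).
exists (c + \sum_j b' 0 j *: d j).
rewrite mulmxDl -cE bE; congr (_ + _).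
rewrite mulmx_suml {1}(row_sum_delta b') scaler_sumr; apply: eq_bigr => j _.
by rewrite -scalemxAl -dE /= !scalerA mulrC.
Qed.

(** As in Schanuel's lemma, comparing the free cover [rowcomb w] with the given resolution yields a
    section [Psi] of [kappa] over the module [K] of relations. As [K] contains [N] times the free
    module, [Psi] extends to rational coefficients, and [Phi] is its matrix. *)
Lemma pd_le1_dual_basis (P : lmodType ZG) n (w : 'I_n -> P) :
  finite_set [set: P] -> pd_le1 P -> lspan (range w) = setT ->
  exists m (k : 'M[ZG]_(m, n)) (Phi : 'M[QG]_(n, m)),
    dual_basis (@gratr G) w k Phi.
Proof.
move=> Pfin [F1 [F0 [d [e [F1proj F0proj [d_inj e_surj deE]]]]]] wT.
have [N N0 Nw] : exists2 N, (0 < N)%N & forall j, w j *+ N = 0.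
  have /fin_all_exists2[Nj Nj0 Njw] j := finite_torsion (w j) Pfin.
  exists (\prod_j Nj j)%N; first by rewrite prodn_gt0.
  by move=> j; rewrite (bigD1 j) //= mulrnA Njw mul0rn.
have [m [k [kw kgen]]] := relations_fg N0 Nw.
have w_surj y : exists v, rowcomb w v = y.
  have /lspan_rangeP[c ->] : lspan (range w) y by rewrite wT.
  exists (\row_j c j); apply: eq_bigr => j _; first by rewrite mxE.
(* Comparison maps in both directions between the covers of [P]. Then [alpha \o d] and
   [idfun \- (alpha \o beta)] take values in [K] and lift along [kappa]. *)
have [alpha alphaE] := F0proj _ _ (rowcomb w) e w_surj.
have [beta betaE] := @row_projective _ n _ _ e (rowcomb w) e_surj.
pose K : lmodType ZG := lsub (range (fun i => row i k)).
have Kin b : rowcomb w b = 0 -> b \in lspanb (range (fun i => row i k)).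
  move=> /kgen[c ->]; apply/lspanbP/lspan_rangeP.
  by exists (c 0); rewrite mulmx_sum_row.
pose kappa : {linear 'rV[ZG]_m -> K} :=
  rowcomb (fun i => LSub (introT (lspanbP _ _)
    (lspan_incl (imageT (fun i => row i k) i))) : K).
have kappaE v : val (kappa v) = v *m k.
  by rewrite mulmx_sum_row linear_sum; apply: eq_bigr => i _; rewrite linearZZ.
have kappa_surj y : exists v, kappa v = y.
  case: y => y yk; have /lspanbP/lspan_rangeP[c cE] := yk.
  exists (\row_i c i); apply: val_inj; rewrite kappaE mulmx_sum_row /= cE.
  by apply: eq_bigr => i _; rewrite mxE.
have dS x : (alpha \o d) x \in lspanb (range (fun i => row i k)).
  by apply: Kin => /=; rewrite [LHS]alphaE; apply/deE; exists x.
have bS b : (idfun \- (alpha \o beta)) b \in lspanb (range (fun i => row i k)).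
  by apply: Kin; rewrite linearB /= [X in _ - X]alphaE [X in _ - X]betaE subrr.
have [dl dlE] := F1proj _ _ kappa (lcorestr dS) kappa_surj.
have [L LE] := @row_projective _ n _ _ kappa (lcorestr bS) kappa_surj.
(* On relations [gam] is the preimage of [beta b] under [d], and its linearity there comes from the
   injectivity of [d]; elsewhere its values are unspecified. *)
have /choice[gam gamE] b : exists x, rowcomb w b = 0 -> d x = beta b.
  have [bw|nbw] := pselect (rowcomb w b = 0); last by exists 0.
  have /deE[x xE] : e (beta b) = 0 by rewrite -bw; apply: betaE.
  by exists x.
(* A relation [b] is the sum of [alpha (d (gam b))] and [b - alpha (beta b)]; both summands are
   lifted. *)
pose Psi b := dl (gam b) + L b.
have PsiE b : rowcomb w b = 0 -> Psi b *m k = b.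
  move=> bw; rewrite mulmxDl -!kappaE.
  have /(congr1 val) /= -> := dlE (gam b).
  have /(congr1 val) /= -> := LE b.
  by rewrite gamE // addrC subrK.
have PsiN b : rowcomb w b = 0 ->
    N%:R *: Psi b = \sum_j b 0 j *: Psi (N%:R *: delta_mx 0 j).
  move=> bw; have Nb : N%:R *: b = \sum_j b 0 j *: (N%:R *: delta_mx 0 j).
    rewrite {1}(row_sum_delta b) scaler_sumr; apply: eq_bigr => j _.
    by rewrite !scalerA mulrC.
  have Ne j : rowcomb w (N%:R *: delta_mx 0 j) = 0.
    by rewrite linearZZ /= rowcomb_delta scaler_nat Nw.
  have gN : N%:R *: gam b = \sum_j b 0 j *: gam (N%:R *: delta_mx 0 j).
    apply: d_inj; rewrite linearZZ gamE // -linearZZ Nb !linear_sum.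
    by apply: eq_bigr => j _; rewrite linearZZ [RHS]linearZZ (gamE _ (Ne j)).
  rewrite scalerDr -!linearZZ gN Nb !linear_sum -big_split; apply: eq_bigr => j _.
  by rewrite [in RHS]/Psi scalerDr (linearZZ dl) (linearZZ L).
pose cN : QG := gconst G (N%:R^-1 : rat).
have cNK (a : QG) : cN * (N%:R * a) = a by rewrite mulrA gconst_natV // mul1r.
have sc (a : ZG) p (v : 'rV[ZG]_p) i : (a *: v) 0 i = a * v 0 i by rewrite mxE.
pose Phi : 'M[QG]_(n, m) :=
  \matrix_(j, i) (cN * gratr (Psi (N%:R *: delta_mx 0 j) 0 i)).
exists m, k, Phi; split=> // [b bw|].
  exists (Psi b); first by rewrite PsiE.
  apply/rowP => i; rewrite mxE [RHS]mxE -[LHS]cNK.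
  have := congr1 (fun v : 'rV_m => gratr (v 0 i)) (PsiN b bw).
  rewrite mxE rmorphM rmorph_nat /= => ->; rewrite summxE rmorph_sum mulr_sumr.
  by apply: eq_bigr => j _; rewrite sc [Phi _ _]mxE
    [map_mx _ _ _ _]mxE rmorphM mulrCA.
apply/matrixP => j j'; rewrite mxE [RHS]mxE.
have Ne : rowcomb w (N%:R *: delta_mx 0 j) = 0.
  by rewrite linearZZ /= rowcomb_delta scaler_nat Nw.
have := congr1 (fun v : 'rV_n => cN * gratr (v 0 j')) (PsiE _ Ne).
rewrite [(_ *m _) _ _]mxE sc [delta_mx _ _ _ _]mxE eqxx /=.
rewrite rmorphM !rmorph_nat cNK eq_sym => <-.
rewrite rmorph_sum mulr_sumr; apply: eq_bigr => i _.
by rewrite [Phi _ _]mxE [map_mx _ _ _ _]mxE rmorphM mulrA.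
Qed.

End GroupRingFacts.

(** * Norms and syzygies in the group ring *)

Section Norms.
Variables (R : comNzRingType) (G : finAbGroupType).
Implicit Types (H K : {group G}) (a : gring R G).

Lemma gcoef_eltM x a y : gcoef (gelt R x * a) y = gcoef a (x^-1 * y)%g.
Proof.
rewrite gcoefM (bigD1 x) //= big1 => [|w /negbTE wx].
  by rewrite gcoef_elt eqxx mul1r addr0.
by rewrite gcoef_elt wx mul0r.
Qed.

Lemma geltM x y : gelt R (x * y)%g = gelt R x * gelt R y :> gring R G.
Proof.
apply: gringP => z; rewrite gcoef_eltM !gcoef_elt.
by rewrite -[in RHS](inj_eq (mulgI x)) mulKVg.
Qed.

Lemma gelt1 : gelt R 1%g = 1 :> gring R G. Proof. by []. Qed.

Lemma gelt_gsum H h : h \in H -> gelt R h * gsum R H = gsum R H.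
Proof.
move=> hH; rewrite /gsum mulr_sumr [RHS](reindex_inj (mulgI h)).
by apply: eq_big => x; rewrite ?groupMl // geltM.
Qed.

Lemma gsum_aug0 H h : h \in H -> gsum R H * (gelt R h - 1) = 0.
Proof. by move=> hH; rewrite mulrBr mulr1 mulrC gelt_gsum ?subrr. Qed.

Lemma coset_eqE H x y : (coset H x == coset H y) = (x * y^-1 \in H)%g.
Proof.
by rewrite -mem_rcoset; apply/eqP/idP => /rcoset_kercosetP; apply; apply: abg_norm.
Qed.

Lemma gcoef_gsumM H a x : gcoef (gsum R H * a) x = gcoef (gproj H a) (coset H x).
Proof.
rewrite gprojE /gsum mulr_suml gcoef_sum.
under eq_bigr => h _ do rewrite gcoef_eltM.
rewrite [RHS](reindex_inj (mulIg x)) [RHS](reindex_inj invg_inj).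
by apply: eq_bigl => h; rewrite coset_eqE mulgK groupV.
Qed.

(** By [gcoef_gsumM], the coefficients of [gsum R H * a] are constant on each coset, with value the
    coefficient of [gproj H a]. *)
Lemma gproj_eq0 H a : gproj H a = 0 <-> gsum R H * a = 0.
Proof.
split=> [Ha|Ha].
  by apply: gringP => x; rewrite gcoef_gsumM Ha /gcoef !ffunE.
apply: gringP => y; have [x _ ->] := cosetP y.
by rewrite -gcoef_gsumM Ha /gcoef !ffunE.
Qed.

Lemma coset_repr_mem H x : (x * (fingroup.repr (coset H x))^-1 \in H)%g.
Proof. by rewrite -coset_eqE coset_reprK. Qed.

(** Replacing each group element by the representative [r x] of its coset turns [a] into 0, so [a]
    is a combination of the differences [gelt R x - gelt R (r x)]. *)
Lemma ker_gproj_gen H a : gsum R H * a = 0 ->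
  ideal_gen [set gelt R h - 1 | h in [set` H]] a.
Proof.
move=> Ha; pose r x := fingroup.repr (coset H x).
have aE : a = \sum_x gconst G (gcoef a x) * gelt R x.
  apply: gringP => y; rewrite gcoef_sum (bigD1 y) //= big1 => [|x /negbTE xy].
    by rewrite gcoef_constM gcoef_elt eqxx mulr1 addr0.
  by rewrite gcoef_constM gcoef_elt eq_sym xy mulr0.
have rE : \sum_x gconst G (gcoef a x) * gelt R (r x) = 0.
  apply: gringP => y; rewrite gcoef_sum [RHS]/gcoef ffunE.
  under eq_bigr => x _ do rewrite gcoef_constM gcoef_elt.
  have [yr|yr] := eqVneq y (r y); last first.
    rewrite big1 // => x _; case: eqP => [yx|]; last by rewrite mulr0.
    by case/eqP: yr; rewrite yx /r coset_reprK.
  have /gproj_eq0/(congr1 (fun b => gcoef b (coset H y))) := Ha.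
  rewrite gprojE [X in _ = X]/gcoef ffunE => E; rewrite -[RHS]E [RHS]big_mkcond.
  apply: eq_bigr => x _.
  rewrite (_ : (y == r x) = (coset H x == coset H y)).
    by case: ifP; rewrite ?mulr1 ?mulr0.
  by apply/eqP/eqP => [->|xy]; rewrite ?coset_reprK // yr /r xy.
have -> : a = \sum_x gconst G (gcoef a x) * (gelt R x - gelt R (r x)).
  under eq_bigr => x _ do rewrite mulrBr.
  by rewrite sumrB -aE rE subr0.
apply: ideal_gen_sum => x _; apply: ideal_genMl.
have -> : gelt R x - gelt R (r x) =
    gelt R (r x) * (gelt R (x * (r x)^-1)%g - 1).
  by rewrite mulrBr mulr1 -geltM abgC mulgKV.
apply/ideal_genMl/ideal_gen_incl; exists (x * (r x)^-1)%g => //.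
exact: coset_repr_mem.
Qed.

(** An invariant element is determined by its coefficients at coset representatives; [c] keeps these
    and is 0 elsewhere. *)
Lemma gsum_divides H a : (forall h, h \in H -> gelt R h * a = a) ->
  exists c, a = gsum R H * c.
Proof.
move=> Ha; pose r x := fingroup.repr (coset H x).
exists ([ffun y => if y == r y then gcoef a y else 0] : {ffun G -> R}).
apply: gringP => y; rewrite gcoef_gsumM gprojE.
rewrite (bigD1 (r y)) ?coset_reprK //= big1 ?addr0 => [|x /andP[/eqP xy xr]].
  rewrite /gcoef ffunE {1 2}/r coset_reprK eqxx -/(gcoef _ _) -/(gcoef _ _).
  by rewrite -[in LHS](Ha _ (coset_repr_mem H y)) gcoef_eltM invMg invgK mulgKV.
by rewrite /gcoef ffunE {1}/r xy (negbTE xr).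
Qed.

Lemma gproj_surj H (b : gring R (coset_of H)) : exists a, gproj H a = b.
Proof.
exists ([ffun x => if x == fingroup.repr (coset H x) then gcoef b (coset H x)
                   else 0] : {ffun G -> R}).
apply: gringP => y; rewrite gprojE (bigD1 (fingroup.repr y)) ?coset_reprK //=.
rewrite big1 ?addr0 => [|x /andP[/eqP xy xr]].
  by rewrite /gcoef ffunE coset_reprK eqxx.
by rewrite /gcoef ffunE xy (negbTE xr).
Qed.

Lemma fix_cycle (x : G) a : gelt R x * a = a ->
  forall h, h \in <[x]>%g -> gelt R h * a = a.
Proof.
move=> xa _ /cycleP[i ->]; elim: i => [|i IHi]; first by rewrite gelt1 mul1r.
by rewrite expgS geltM -mulrA IHi.
Qed.

Lemma gsum_dprod (H K L : {group G}) :
  (H \x K = L)%g -> gsum R L = gsum R H * gsum R K.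
Proof.
case/dprodP=> _ HK _ tiHK; rewrite /gsum mulr_suml.
under [RHS]eq_bigr => x _ do rewrite mulr_sumr.
rewrite pair_big /= -HK.
rewrite (_ : (H * K)%g = [set (p.1 * p.2)%g | p in finset.setX H K]%SET); last first.
  apply/setP => z; apply/mulsgP/imsetP => [[x y Hx Ky ->]|[[x y]]].
    by exists (x, y); rewrite ?inE ?Hx.
  by rewrite inE => /andP[Hx Ky] ->; exists x y.
rewrite big_imset /=; last first.
  move=> [x y] [x' y']; rewrite !inE /= => /andP[Hx Ky] /andP[Hx' Ky'] E.
  have E' : (x'^-1 * x = y' * y^-1)%g.
    by apply: (mulgI x'); apply: (mulIg y); rewrite mulKVg E -!mulgA mulVg mulg1.
  have : (x'^-1 * x)%g \in H :&: K.
    by rewrite inE {2}E' !groupM ?groupV.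
  rewrite tiHK => /set1P E1; rewrite E1 in E'.
  have xx : x = x' by rewrite -[x](mulKVg x') E1 mulg1.
  by rewrite xx; congr pair; apply/eqP; rewrite eq_sym eq_mulgV1 -E'.
by apply: eq_big => [p|p _]; rewrite ?inE // geltM.
Qed.

(** * Augmentation ideals for a decomposition of I *)

Section Decomposition.
Variables (s : nat) (Is : 'I_s -> {group G}) (I : {group G}) (sg : 'I_s -> G).
Hypothesis Is_sg : forall l, Is l = <[sg l]>%g :> {set G}.
Hypothesis Is_prod : \big[dprod/1%g]_(l < s) (Is l : {set G}) = I.

Lemma Is_sub l : Is l \subset I.
Proof. by rewrite -(bigdprodWY Is_prod) sub_gen // (finset.bigcup_sup l). Qed.

Lemma sg_mem l : sg l \in I.
Proof. by apply: (fintype.subsetP (Is_sub l)); rewrite Is_sg cycle_id. Qed.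

(** Being a group, this set contains a subgroup as soon as it contains generators of it; this
    reduces augmentation ideals to generators. *)
Lemma aug_group (T : set (gring R G)) :
  group_set [set h : G | `[< ideal_gen T (gelt R h - 1) >]]%SET.
Proof.
apply/group_setP; split.
  rewrite finset.in_set; apply/asboolP; rewrite gelt1 subrr; exact: ideal_gen0.
move=> x y; rewrite !finset.in_set => /asboolP Tx /asboolP Ty; apply/asboolP.
have -> : gelt R (x * y)%g - 1 = gelt R x * (gelt R y - 1) + (gelt R x - 1).
  by rewrite geltM mulrBr mulr1 addrA subrK.
by apply: ideal_genD => //; apply: ideal_genMl.
Qed.

Lemma aug_gens h : h \in I ->
  ideal_gen (range (fun l => gelt R (sg l) - 1)) (gelt R h - 1).
Proof.
set T := range _; suff sub : I \subset Group (aug_group T).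
  by move=> hI; have := fintype.subsetP sub h hI; rewrite finset.in_set => /asboolP.
rewrite -(bigdprodWY Is_prod) gen_subG; apply/finset.bigcupsP => l _.
rewrite Is_sg cycle_subG finset.in_set; apply/asboolP/ideal_gen_incl.
by exists l.
Qed.

Lemma ker_gproj_sg a : gsum R I * a = 0 ->
  ideal_gen (range (fun l => gelt R (sg l) - 1)) a.
Proof.
move/ker_gproj_gen; apply: ideal_gen_sub => _ [h hI <-]; exact: aug_gens.
Qed.

End Decomposition.

Lemma gsum_bigdprod s (Is : 'I_s -> {group G}) (I : {group G}) :
  \big[dprod/1%g]_(l < s) (Is l : {set G}) = I ->
  gsum R I = \prod_l gsum R (Is l).
Proof.
elim: s Is I => [|s IHs] Is I.
  by rewrite !big_ord0 => <-; rewrite /gsum big_set1.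
rewrite big_ord_recr /= => def; have [[K L K_E L_E] _ _ _] := dprodP def.
rewrite big_ord_recr /= -(IHs (fun l => Is (widen_ord (leqnSn s) l)) K) //.
by apply: gsum_dprod; rewrite -K_E.
Qed.

(* The last coefficient is determined modulo the ideal of the previous
   [gelt (sg l) - 1] by multiplying with the norm of the previous factors. *)
Lemma sg_syzygies s (Is : 'I_s -> {group G}) (I : {group G}) (sg : 'I_s -> G) :
  (forall l, Is l = <[sg l]>%g :> {set G}) ->
  \big[dprod/1%g]_(l < s) (Is l : {set G}) = I ->
  forall a : 'I_s -> gring R G, \sum_l a l * (gelt R (sg l) - 1) = 0 ->
  exists (c : 'I_s -> gring R G) (S : 'I_s -> 'I_s -> gring R G),
    [/\ forall k j, S k j = - S j k, forall k, S k k = 0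
      & forall j, a j = c j * gsum R (Is j) +
                        \sum_k (gelt R (sg k) - 1) * S k j].
Proof.
elim: s Is I sg => [|s IHs] Is I sg Is_sg.
  move=> _ a _; exists (fun=> 0), (fun=> fun=> 0).
  by split=> [||[]] // *; rewrite oppr0.
rewrite big_ord_recr /= => def a; have [[K L K_E L_E] _ _ _] := dprodP def.
pose w := widen_ord (leqnSn s); rewrite -/w in K_E.
rewrite big_ord_recr /= -/w.
set t := fun l => gelt R (sg l) - 1; move=> rel.
have Is_w l : Is (w l) = <[sg (w l)]>%g :> {set G} by [].
(* The norm of [K] kills all terms of the relation but the last, so [gsum R K * a ord_max] is fixed
   by the last generator. It is also fixed by [K], hence a multiple of [gsum R I]. *)
have inv : gelt R (sg ord_max) * (gsum R K * a ord_max) = gsum R K * a ord_max.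
  apply/eqP; rewrite -subr_eq0; apply/eqP.
  transitivity (gsum R K * (a ord_max * t ord_max)); first by rewrite /t; ring.
  have := congr1 (fun b => gsum R K * b) rel.
  rewrite mulrDr mulr_sumr big1 ?add0r ?mulr0 // => l _.
  rewrite mulrCA gsum_aug0 ?mulr0 //; exact: (sg_mem Is_w K_E).
have [c0 c0E] : exists c, gsum R K * a ord_max = gsum R I * c.
  apply: gsum_divides => h.
  have /dprodP[_ <- _ _] := def; rewrite K_E => /mulsgP[x y Kx].
  rewrite Is_sg => /(fix_cycle inv) Ly ->.
  by rewrite geltM -mulrA Ly mulrA gelt_gsum.
have /(ker_gproj_sg Is_w K_E)/(@lspan_rangeP _ (gring R G)^o)[b bE] :
    gsum R K * (a ord_max - c0 * gsum R (Is ord_max)) = 0.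
  have -> : gsum R K * (a ord_max - c0 * gsum R (Is ord_max)) =
    gsum R K * a ord_max - (gsum R K * gsum R (Is ord_max)) * c0 by ring.
  have defK : (K \x Is ord_max)%g = I by rewrite -K_E.
  by rewrite -(gsum_dprod defK) c0E subrr.
have amax : a ord_max = c0 * gsum R (Is ord_max) + \sum_l t (w l) * b l.
  rewrite -[LHS](subrK (c0 * gsum R (Is ord_max))) bE addrC; congr (_ + _).
  by apply: eq_bigr => l _; rewrite mulrC.
(* Moving the terms [t (w l) * b l] of the last coefficient to the previous coefficients leaves a
   syzygy of length [s], since [t ord_max] kills the last norm. *)
have [|c [S [Salt S0 SE]]] := IHs (Is \o w) K (sg \o w) Is_w K_E
    (fun l => a (w l) + t ord_max * b l).
  under eq_bigr => l _ do rewrite mulrDl.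
  rewrite big_split /=; move/eqP: rel; rewrite addr_eq0 => /eqP ->.
  rewrite amax mulrDl -/t -/(t ord_max).
  have -> : c0 * gsum R (Is ord_max) * t ord_max = 0.
    by rewrite -mulrA gsum_aug0 ?mulr0 // Is_sg cycle_id.
  rewrite add0r mulr_suml -sumrN -big_split big1 //= => l _.
  by rewrite /t; ring.
pose u (l : 'I_s.+1) := unlift ord_max l.
have uw l : u (w l) = Some l.
  rewrite /u (_ : w l = lift ord_max l) ?liftK //.
  by apply: val_inj; rewrite /= /bump leqNgt ltn_ord.
have um : u ord_max = None by rewrite /u unlift_none.
(* The coefficients [b] form the last column of the alternating family, and their opposites the last
   row. *)
pose S' k j := match u k, u j with
  | Some k', Some j' => S k' j' | Some k', None => b k'
  | None, Some j' => - b j' | None, None => 0 end.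
exists (fun j => if u j is Some j' then c j' else c0), S'.
split=> [k j|k|j].
- by rewrite /S'; case: (u k) (u j) => [k'|] [j'|] //; rewrite ?opprK ?oppr0.
- by rewrite /S'; case: (u k).
rewrite big_ord_recr /= -/w.
have [j' ->|->] := unliftP ord_max j.
  have -> : lift ord_max j' = w j' by apply: val_inj; rewrite /= /bump leqNgt ltn_ord.
  rewrite /S' um uw; under eq_bigr => k _ do rewrite uw.
  apply: (@addIr _ (t ord_max * b j')); rewrite SE -!addrA; congr (_ + _).
  by rewrite /t /= mulrN addNr addr0.
rewrite /S' um amax mulr0 addr0; congr (_ + _).
by apply: eq_bigr => k _; rewrite uw.
Qed.

End Norms.

(** * Minors of Koszul relations *)

Section Determinants.
Variable R : comNzRingType.

Lemma det_sum_cols s (K : finType) (F : K -> 'M[R]_s) :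
  \det (\sum_k F k) =
  \sum_(f : {ffun 'I_s -> K}) \det (\matrix_(i, j) F (f j) i j).
Proof.
under [RHS]eq_bigr => f _ do rewrite -det_tr.
rewrite -det_tr /determinant exchange_big /=; apply: eq_bigr => p _.
rewrite -mulr_sumr; congr (_ * _).
under eq_bigr => i _ do rewrite mxE summxE.
rewrite bigA_distr_bigA; apply: eq_bigr => f _.
by apply: eq_bigr => i _; rewrite !mxE.
Qed.

(** In the presence of [a], each factor matters only modulo the annihilator of [a]. *)
Lemma eq_mul_prod (J : Type) (r : seq J) (a : R) (F F' : J -> R) :
  (forall j, a * F j = a * F' j) ->
  a * \prod_(j <- r) F j = a * \prod_(j <- r) F' j.
Proof.
move=> FF'; elim: r => [|j r IHr]; first by rewrite !big_nil.
by rewrite !big_cons mulrCA IHr mulrCA mulrA FF' -mulrA.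
Qed.

Lemma alternating_form0 (A : comNzRingType) s (x : 'I_s -> A) (S : 'I_s -> 'I_s -> A) :
  (forall k j, S k j = - S j k) -> (forall k, S k k = 0) ->
  \sum_j (\sum_k x k * S k j) * x j = 0.
Proof.
move=> Salt S0; pose T k j := x k * S k j * x j.
have -> : \sum_j (\sum_k x k * S k j) * x j = \sum_j \sum_k T k j.
  by apply: eq_bigr => j _; rewrite mulr_suml.
have -> : \sum_j \sum_k T k j =
    \sum_(j < s) (\sum_(k : 'I_s | (k < j)%N) T k j +
                  \sum_(k : 'I_s | (j < k)%N) T k j).
  apply: eq_bigr => j _; rewrite (bigID (fun k : 'I_s => (k < j)%N)) /=.
  congr (_ + _); rewrite (bigD1 j) ?ltnn //= {1}/T S0 mulr0 mul0r add0r.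
  by apply: eq_bigl => k; rewrite -leqNgt ltn_neqAle andbC eq_sym.
rewrite big_split /= [X in _ + X](exchange_big_dep predT) //= -big_split big1 //=.
move=> j _; rewrite -big_split big1 //= => k _.
by rewrite /T (Salt j k); ring.
Qed.

(* Over R the entries of [t] may be zero divisors; adding ['X] to the entry [c]
   makes it monic, hence regular, and the relation [M t = 0] then forces
   [\det M = 0]. *)
Lemma det_alternating_cols s (L : pred 'I_s) (C : 'M[R]_s) (t : 'I_s -> R)
    (S : 'I_s -> 'I_s -> 'I_s -> R) (c : 'I_s) :
  (forall i k j, S i k j = - S i j k) -> (forall i k, S i k k = 0) ->
  (forall j, L j -> t j = 0) -> ~~ L c ->
  \det (\matrix_(i, j) if L j then C i j else \sum_k t k * S i k j) = 0.
Proof.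
move=> Salt S0 tL Lc; set M := (X in \det X).
pose tX k : {poly R} := (t k)%:P + (k == c)%:R * 'X.
pose MX : 'M[{poly R}]_s := \matrix_(i, j)
  if L j then (C i j)%:P else \sum_k tX k * (S i k j)%:P.
have -> : M = map_mx (horner_eval 0) MX.
  apply/matrixP => i j; rewrite !mxE /horner_eval; case: ifP => _.
    by rewrite hornerC.
  rewrite horner_sum; apply: eq_bigr => k _.
  by rewrite hornerM hornerC /tX !hornerE ?mulr0 ?addr0.
rewrite det_map_mx; have -> : \det MX = 0; last by rewrite rmorph0.
(* Columns in [L] meet a zero coordinate, as [c] is not in [L]; the other columns give an
   alternating form. *)
have MXt : MX *m (\col_k tX k) = 0.
  apply/matrixP => i j; rewrite !mxE.
  rewrite -[RHS](@alternating_form0 _ _ tX (fun k j => (S i k j)%:P)); first last.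
  - by move=> k; rewrite S0.
  - by move=> k l; rewrite Salt polyCN.
  apply: eq_bigr => k _; rewrite !mxE; case: ifP => // Lk.
  rewrite /tX tL // (_ : k == c = false) ?mul0r ?addr0 ?mulr0 //.
  by apply/eqP => kc; rewrite -kc Lk in Lc.
have : \det MX * tX c = 0.
  have := congr1 (fun v => \adj MX *m v) MXt; rewrite mulmxA mul_adj_mx mulmx0.
  by move/matrixP/(_ c 0); rewrite mul_scalar_mx !mxE.
have tXc : tX c \is monic by rewrite /tX eqxx mul1r addrC monicXaddC.
by move=> E; apply: (monic_rreg tXc); rewrite E mul0r.
Qed.


(** * Norm and Koszul relations together *)

Section KoszulMinors.
Variables (s : nat) (nu t : 'I_s -> R) (g : R).

(** The factor contributed by column [j] once the columns are split: a norm, an element of the ideal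
    of the [t], or [g]. *)
Definition koszul_factor (f : 'I_s -> 'I_3) (u : 'I_s -> R) (j : 'I_s) : R :=
  match val (f j) with 0%N => nu j | 1%N => u j | _ => g end.

Hypothesis nu_t : forall j, nu j * t j = 0.

(** The product [N] of the norms in [L] kills [t k] for [k] in [L]. Once [N] is pulled out of the
    columns, these [t k] may be set to 0, and [det_alternating_cols] applies. *)
Lemma koszul_det_vanish (C : 'M[R]_s) (S : 'I_s -> 'I_s -> 'I_s -> R)
    (L : pred 'I_s) (c : 'I_s) :
  (forall i k j, S i k j = - S i j k) -> (forall i k, S i k k = 0) ->
  ~~ L c ->
  \det (\matrix_(i, j) if L j then nu j * C i j else \sum_k t k * S i k j) = 0.
Proof.
move=> Salt S0 Lc; pose N := \prod_(j | L j) nu j.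
pose t' k := if L k then 0 else t k.
have Nt k : N * t k = N * t' k.
  rewrite /t'; case: ifP => // Lk; rewrite /N (bigD1 k) //= mulr0.
  by rewrite mulrAC nu_t mul0r.
have -> : \det (\matrix_(i, j) if L j then nu j * C i j else \sum_k t k * S i k j)
    = N * \det (\matrix_(i, j) if L j then C i j else \sum_k t k * S i k j).
  have -> : N = \det (diag_mx (\row_j if L j then nu j else 1)).
    rewrite det_diag /N big_mkcond; apply: eq_bigr => j _.
    by rewrite mxE.
  rewrite mulrC -det_mulmx; congr (\det _); apply/matrixP => i j.
  rewrite mul_mx_diag !mxE; case: ifP => _; last by rewrite mulr1.
  by rewrite mulrC.
transitivity (N *
    \det (\matrix_(i, j) if L j then C i j else \sum_k t' k * S i k j)).
  2: by rewrite (@det_alternating_cols _ L C t' S c) ?mulr0 // => j; rewrite /t' => ->.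
rewrite /determinant !mulr_sumr; apply: eq_bigr => p _.
rewrite mulrCA [RHS]mulrCA; congr (_ * _); apply: eq_mul_prod => j.
rewrite !mxE; case: ifP => // _; rewrite !mulr_sumr; apply: eq_bigr => k _.
by rewrite mulrA Nt mulrA.
Qed.

(** Each column splits into a norm part, a Koszul part and a multiple of [g]. Of the terms without
    [g], those with a Koszul column vanish and the remaining one is a multiple of [\prod_j nu j].
    The predicate [Q] abstracts membership in an ideal. *)
Lemma koszul_det (Q : R -> Prop) (C E : 'M[R]_s)
    (S : 'I_s -> 'I_s -> 'I_s -> R) :
  (forall i k j, S i k j = - S i j k) -> (forall i k, S i k k = 0) ->
  Q 0 -> (forall a x y, Q x -> Q y -> Q (a * x + y)) ->
  Q (\prod_j nu j) ->
  (forall (f : {ffun 'I_s -> 'I_3}) u i, val (f i) = 2%N ->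
     (forall j, ideal_gen (range t) (u j)) ->
     Q (\prod_j koszul_factor f u j)) ->
  Q (\det (\matrix_(i, j) (C i j * nu j + \sum_k t k * S i k j + g * E i j))).
Proof.
move=> Salt S0 Q0 QD Qnu Qg.
have Qsum (J : finType) (F : J -> R) : (forall j, Q (F j)) -> Q (\sum_j F j).
  move=> QF; elim/big_rec: _ => // j x _ Qx.
  by rewrite -[F j]mul1r; apply: QD.
have QM a x : Q x -> Q (a * x) by move=> Qx; rewrite -[_ * _]addr0; apply: QD.
pose K i j := \sum_k t k * S i k j.
have Kt i j : ideal_gen (range t) (K i j).
  apply: ideal_gen_sum => k _; apply/ideal_genMr/ideal_gen_incl.
  by exists k.
pose F (k : 'I_3) : 'M[R]_s := \matrix_(i, j)
  match val k with 0%N => nu j * C i j | 1%N => K i j | _ => g * E i j end.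
have -> : (\matrix_(i, j) (C i j * nu j + K i j + g * E i j)) = \sum_k F k.
  apply/matrixP => i j; rewrite !big_ord_recl big_ord0 !mxE /= addr0 addrA.
  by rewrite [nu j * _]mulrC.
rewrite det_sum_cols; apply: (Qsum) => f.
have [i fi|no2] := pickP (fun i => val (f i) == 2%N).
  rewrite -det_tr; apply: (Qsum) => p; apply: (QM).
  pose u j := K (p j) j.
  pose co j := match val (f j) with
    | 0%N => C (p j) j | 1%N => 1 | _ => E (p j) j end.
  have -> : \prod_j (\matrix_(i, j) F (f j) i j)^T j (p j) =
      (\prod_j co j) * \prod_j koszul_factor f u j.
    rewrite -big_split; apply: eq_bigr => j _; rewrite !mxE /co /koszul_factor.
    by case: (val (f j)) => [|[|m]] /=; rewrite ?mul1r // mulrC.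
  by apply/QM/(Qg f u i (eqP fi)) => j; apply: Kt.
have f01 j : val (f j) = (val (f j) != 0%N) :> nat.
  by have := no2 j; case: (f j) => -[|[|[|]]].
pose L j := val (f j) == 0%N.
have -> : (\matrix_(i, j) F (f j) i j) =
    \matrix_(i, j) if L j then nu j * C i j else \sum_k t k * S i k j.
  by apply/matrixP => i j; rewrite !mxE /L f01; case: (val (f j)).
have [c Lc|all0] := pickP (fun c => ~~ L c).
  by rewrite (@koszul_det_vanish C S L c).
have -> : (\matrix_(i, j) if L j then nu j * C i j else \sum_k t k * S i k j)
    = C *m diag_mx (\row_j nu j).
  apply/matrixP => i j; have /negbFE Lj := all0 j.
  by rewrite mul_mx_diag !mxE Lj mulrC.
rewrite det_mulmx det_diag; apply: (QM).
by under eq_bigr => j _ do rewrite mxE.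
Qed.

(* Removing a vertex [c] outside [w] peels one factor [t l] off: the row
   [t l * e_c - t c * e_l] meets the column [c] only at [c]. *)
Lemma koszul_forest (Rel : 'rV[R]_s -> Prop) (w : seq 'I_s) (A : {set 'I_s}) :
  (forall l, Rel (g *: delta_mx 0 l)) ->
  (forall l c, Rel (t l *: delta_mx 0 c - t c *: delta_mx 0 l)) ->
  {subset w <= A} -> (size w <= #|A|.-1)%N ->
  exists B : 'M[R]_s,
    [/\ forall i, i \in A -> Rel (row i B),
        forall i j, i \notin A -> B i j = (i == j)%:R,
        forall i j, i \in A -> j \notin A -> B i j = 0
      & \det B = g ^+ (#|A| - size w) * \prod_(l <- w) t l].
Proof.
move=> Relg Relt; elim: w A => [|l w IHw] A wA szw.
  exists (diag_mx (\row_j if j \in A then g else 1)); split.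
  - move=> i iA; rewrite (_ : row i _ = g *: delta_mx 0 i) //.
    apply/rowP => j; rewrite !mxE eqxx /=.
    by case: (eqVneq i j) => _; rewrite ?iA ?mulr1 ?mulr0.
  - by move=> i j iA; rewrite !mxE; case: eqVneq => // _; rewrite (negbTE iA).
  - by move=> i j iA jA; rewrite !mxE; case: eqP => // ij; rewrite ij (negbTE jA) in iA.
  rewrite det_diag big_nil mulr1 subn0 -prodr_const [RHS]big_mkcond.
  by apply: eq_bigr => j _; rewrite mxE.
have [c cA cw] : exists2 c, c \in A & c \notin l :: w.
  have [c /andP[cA cw]|none] := pickP (fun c => (c \in A) && (c \notin l :: w)).
    by exists c.
  have Aw : (#|A| <= size (l :: w))%N.
    apply: leq_trans (card_size _); apply/subset_leq_card/fintype.subsetP => x xA.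
    by have := none x; rewrite xA => /negbFE.
  by have := leq_trans Aw szw; move: szw; case: #|A| => //= k; rewrite ltnn.
have lc : l != c by apply: contra cw => /eqP->; rewrite mem_head.
have lA : l \in A by apply: wA; rewrite mem_head.
pose A' := A :\ c.
have cardA : #|A| = #|A'|.+1 by rewrite (cardsD1 c A) cA.
have wA' : {subset w <= A'}.
  move=> x xw; rewrite !inE wA ?inE ?xw ?orbT // andbT.
  by apply: contra cw => /eqP<-; rewrite inE xw orbT.
have [|B' [B'Rel B'1 B'0 B'det]] := IHw A' wA'.
  by move: szw; rewrite cardA /=; case: #|A'|.
pose ro := t l *: delta_mx 0 c - t c *: delta_mx 0 l : 'rV[R]_s.
pose B := \matrix_(i, j) if i == c then ro 0 j else B' i j.
have rowB i : i != c -> row i B = row i B'.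
  by move=> ic; apply/rowP => j; rewrite !mxE (negbTE ic).
have rowBc : row c B = ro by apply/rowP => j; rewrite !mxE eqxx.
have cA' : c \notin A' by rewrite !inE eqxx.
have A'E i : i \in A -> i != c -> i \in A' by move=> iA ic; rewrite !inE ic.
exists B; split.
- move=> i iA; have [->|ic] := eqVneq i c; first by rewrite rowBc; apply: Relt.
  by rewrite rowB //; apply/B'Rel/A'E.
- move=> i j iA; have ic : i != c by apply: contraNneq iA => ->.
  rewrite mxE (negbTE ic) B'1 //; apply: contra iA; rewrite !inE.
  by case/andP.
- move=> i j iA jA; have jc : j != c by apply: contraNneq jA => ->.
  have jl : j != l by apply: contraNneq jA => ->.
  rewrite mxE; have [_|ic] := eqVneq i c.
    by rewrite /ro !mxE (negbTE jc) (negbTE jl) andbF !mulr0 subr0.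
  have jA' : j \notin A' by apply: contra jA; rewrite !inE => /andP[].
  by apply: B'0 => //; apply: A'E.
(* By linearity in row [c]: [B'] has there the basis vector at [c], and [B2] the one at [l]. Column
   [c] of [B2] is zero, so only [t l * \det B'] remains. *)
pose B2 := \matrix_(i, j) if i == c then (j == l)%:R else B' i j.
rewrite (@determinant_multilinear _ _ B B' B2 c (t l) (- t c)).
- rewrite [X in _ + _ * X](expand_det_col _ c) big1 ?mulr0 ?addr0 => [|i _].
    rewrite B'det big_cons cardA /= subSS mulrCA.
    by [].
  rewrite mxE; have [_|ic] := eqVneq i c.
    by rewrite eq_sym (negbTE lc) mul0r.
  have [iA'|iA'] := boolP (i \in A'); first by rewrite B'0 ?mul0r.
  by rewrite B'1 // (negbTE ic) mul0r.
- rewrite rowBc /ro scaleNr; apply/rowP => j; rewrite !mxE !eqxx /=.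
  by rewrite B'1 // [j == c]eq_sym.
- by apply/matrixP => i j; rewrite !mxE eq_sym (negbTE (neq_lift _ _)).
by apply/matrixP => i j; rewrite !mxE eq_sym (negbTE (neq_lift _ _)).
Qed.

(** The rows in [L] of the matrix given by [koszul_forest] are unit vectors; scaling them by [nu l]
    makes them relations. *)
Lemma koszul_fitt (M : lmodType R) (x : 'I_s -> M) (L : {set 'I_s}) w :
  (forall l, g *: x l = 0) -> (forall l c, t l *: x c = t c *: x l) ->
  (forall l, nu l *: x l = 0) ->
  {subset w <= ~: L} -> (size w <= #|~: L|.-1)%N ->
  fitt_of x (\prod_(l in L) nu l *
    (g ^+ (#|~: L| - size w) * \prod_(l <- w) t l)).
Proof.
move=> gx tx nux wL szw.
have [||B [BRel B1 B0 <-]] :=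
    @koszul_forest (fun v => rowcomb x v = 0) w (~: L) _ _ wL szw.
- by move=> l; rewrite linearZZ /= rowcomb_delta gx.
- by move=> l c; rewrite linearB /= !linearZZ /= !rowcomb_delta tx scalerN subrr.
have -> : \prod_(l in L) nu l = \det (diag_mx (\row_j if j \in L then nu j else 1)).
  by rewrite det_diag big_mkcond; apply: eq_bigr => j _; rewrite mxE.
rewrite -det_mulmx; apply: fitt_of_incl => i; rewrite mul_diag_mx.
under eq_bigr => j _ do rewrite !mxE -scalerA.
rewrite -scaler_sumr; case: ifP => iL.
  rewrite (bigD1 i) //= big1 ?addr0 => [|j ji].
    by rewrite B1 ?inE ?iL // eqxx scale1r nux.
  by rewrite B1 ?inE ?iL // eq_sym (negbTE ji) scale0r.
rewrite scale1r -[RHS](BRel i) ?inE ?iL //.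
by apply: eq_bigr => j _; rewrite mxE.
Qed.

End KoszulMinors.
End Determinants.

(** * Independence of the presentation *)

Section Comparison.

Lemma fitt_of_eqrel (R : comNzRingType) (M N : lmodType R) n
    (x : 'I_n -> M) (y : 'I_n -> N) :
  (forall c : 'I_n -> R, \sum_j c j *: x j = 0 <-> \sum_j c j *: y j = 0) ->
  fitt_of x = fitt_of y.
Proof.
move=> xy; congr ideal_gen; apply/seteqP; split=> _ [B [Bx ->]];
  by exists B; split=> // i; apply/xy/Bx.
Qed.

(** Subtracting from [w] the combination of the [z j] with the same image under [q] leaves an
    element killed by both [q] and [delta]. *)
Lemma lspan_fcat (R : comNzRingType) (M P X : lmodType R)
    (q : {linear M -> P}) (delta : {linear M -> X})
    l n (x : 'I_l -> M) (z : 'I_n -> M) :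
  (forall j, delta (z j) = 0) -> lspan (range (q \o z)) = setT ->
  (forall w, delta w = 0 -> q w = 0 -> lspan (range x) w) ->
  forall w, delta w = 0 -> lspan (range (fcat z x)) w.
Proof.
move=> dz qz kx w dw.
have /lspan_rangeP[c qw] : lspan (range (q \o z)) (q w) by rewrite qz.
rewrite -[w](subrK (\sum_j c j *: z j)); apply: lspanD; last first.
  apply: lspan_sum => j _; apply/lspanZ/lspan_incl.
  by exists (lshift l j); rewrite ?fcat_lshift.
have : lspan (range x) (w - \sum_j c j *: z j).
  apply: kx; rewrite linearB linear_sum /=.
    by rewrite dw big1 ?subr0 // => j _; rewrite linearZZ dz scaler0.
  by apply/eqP; rewrite subr_eq0 qw; apply/eqP/eq_bigr => j _; rewrite linearZZ.
apply: lspan_sub => _ [j _ <-]; apply: lspan_incl.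
by exists (rshift n j); rewrite ?fcat_rshift.
Qed.

Variable G : finAbGroupType.
Local Notation ZG := (gring int G).
Local Notation QG := (gring rat G).

(** The case of an empty [x] in [fitt_of_ext_minor]: it puts the minors of [Phi] into the inverse of
    Fitt(P). *)
Lemma fitt_of_minor_frac (P : lmodType ZG) m n (w : 'I_n -> P)
    (k : 'M[ZG]_(m, n)) (Phi : 'M[QG]_(n, m)) t c :
  dual_basis (@gratr G) w k Phi -> fitt_of w c ->
  exists d, \det (colsub t Phi) * gratr c = gratr d.
Proof.
move=> kPhi wc; pose x (i : 'I_0) : P := 0.
have xw : fitt_of (fcat w x) = fitt_of w.
  apply: fitt_of_span => i.
    rewrite /fcat; case: split => j; last exact: lspan0.
    by apply: lspan_incl; exists j.
  by apply: lspan_incl; exists (lshift 0 i); rewrite ?fcat_lshift.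
have [] := @fitt_of_ext_minor _ _ (@gratr G) P P idfun 0 n x w _ _ m k Phi t c.
- by case.
- move=> b bw; rewrite [X in lspan _ X]bw; exact: lspan0.
- exact: kPhi.
- by rewrite xw.
by move=> d _ dE; exists d.
Qed.

(* Both 0 -> Y -> P -> X -> 0 and the presentation P0 -> X are compared through
   the fibre product of P and P0 over X, the kernel of [delta] below. *)
Lemma Fitt1_compare (X Y P P0 : lmodType ZG) (i : {linear Y -> P})
    (p : {linear P -> X}) (p0 : {linear P0 -> X}) (g : ZG) (gV : QG)
    (e0 : P0) m0 (x0 : 'I_m0 -> P0) :
  finite_set [set: Y] -> finite_set [set: P] -> pd_le1 P -> short_exact i p ->
  gV * gratr g = 1 ->
  (forall u, exists b, u = b *: e0) ->
  (forall b, b *: e0 = 0 <-> exists c, b = c * g) ->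
  (forall x, exists u, p0 u = x) ->
  (forall l, p0 (x0 l) = 0) ->
  (forall u, p0 u = 0 -> lspan (range x0) u) ->
  fracM (fracV (@gratr G @` Fitt P)) (@gratr G @` Fitt Y) =
  [set v | exists2 a, fitt_of x0 a & gratr g * v = gratr a].
Proof.
move=> Yfin Pfin Ppd [i_inj p_surj ipE] gVK e0_gen e0_rel p0_surj p0x0 x0_ker.
have [m [y yT]] := finite_generators Yfin.
have [n [z zT]] := finite_generators Pfin.
have [r [k [Phi kPhi]]] := pd_le1_dual_basis Pfin Ppd zT.
rewrite (FittE yT) (FittE zT).
have /fin_all_exists[b bE] j : exists u, p0 u = p (z j) by apply: p0_surj.
have [a aE] : exists u, p u = p0 e0 by apply: p_surj.
pose M : lmodType ZG := (P * P0)%type.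
pose q1 : {linear M -> P} := fst; pose q2 : {linear M -> P0} := snd.
pose delta : {linear M -> X} := (p \o q1) \- (p0 \o q2).
have deltaE w : delta w = p w.1 - p0 w.2 by [].
(* The kernel of [delta] maps onto [P] with kernel spanned by [x1], and onto [P0] with kernel
   spanned by [x2]; [z1] and [z2] lift generators of [P] and [P0]. *)
pose x1 l : M := (0, x0 l); pose z1 j : M := (z j, b j).
pose x2 l : M := (i (y l), 0); pose z2 (j : 'I_1) : M := (a, e0).
have sum1 N (c : 'I_N -> ZG) (f : 'I_N -> M) :
    (\sum_j c j *: f j).1 = \sum_j c j *: (f j).1.
  by rewrite -[LHS]/(q1 _) linear_sum; apply: eq_bigr => j _; rewrite linearZZ.
have sum2 N (c : 'I_N -> ZG) (f : 'I_N -> M) :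
    (\sum_j c j *: f j).2 = \sum_j c j *: (f j).2.
  by rewrite -[LHS]/(q2 _) linear_sum; apply: eq_bigr => j _; rewrite linearZZ.
have x1_1 (c : 'I_m0 -> ZG) : \sum_j c j *: (x1 j).1 = 0.
  by rewrite big1 // => j _; apply: scaler0.
have x2_2 (c : 'I_m -> ZG) : \sum_j c j *: (x2 j).2 = 0.
  by rewrite big1 // => j _; apply: scaler0.
have dz1 j : delta (z1 j) = 0 by rewrite deltaE bE subrr.
have dz2 j : delta (z2 j) = 0 by rewrite deltaE aE subrr.
have dx1 l : delta (x1 l) = 0 by rewrite deltaE linear0 p0x0 subrr.
have dx2 l : delta (x2 l) = 0.
  by rewrite deltaE linear0 subr0; apply/ipE; exists (y l).
have x1_ker w : delta w = 0 -> q1 w = 0 -> lspan (range x1) w.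
  case: w => w1 w2; rewrite deltaE /q1 /= => dw w10; rewrite w10 in dw *.
  move/eqP: dw; rewrite linear0 sub0r oppr_eq0 => /eqP/x0_ker/lspan_rangeP[c ->].
  apply/lspan_rangeP; exists c.
  by rewrite [RHS]surjective_pairing sum1 sum2 x1_1.
have x2_ker w : delta w = 0 -> q2 w = 0 -> lspan (range x2) w.
  case: w => w1 w2; rewrite deltaE /q2 /= => dw w20; rewrite w20 in dw *.
  move/eqP: dw; rewrite linear0 subr0 => /eqP/ipE[y' <-].
  have /lspan_rangeP[c ->] : lspan (range y) y' by rewrite yT.
  apply/lspan_rangeP; exists c.
  rewrite [RHS]surjective_pairing sum1 sum2 x2_2 linear_sum; congr (_, _).
  by apply: eq_bigr => j _; rewrite linearZZ.
have z2T : lspan (range (q2 \o z2)) = setT.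
  apply/seteqP; split=> // u _; have [c ->] := e0_gen u.
  by apply/lspanZ/lspan_incl; exists 0.
have z1T : lspan (range (q1 \o z1)) = setT by [].
have W12 : fitt_of (fcat z1 x1) = fitt_of (fcat z2 x2).
  apply: fitt_of_span => j.
    apply: (lspan_fcat dz2 z2T x2_ker); rewrite /fcat; case: split => l //.
  apply: (lspan_fcat dz1 z1T x1_ker); rewrite /fcat; case: split => l //.
have Fx1 : fitt_of x1 = fitt_of x0.
  apply: fitt_of_eqrel => c; split=> [/(congr1 snd)|E]; first by rewrite sum2.
  by rewrite [LHS]surjective_pairing sum1 sum2 x1_1 /= E.
have Fx2 : fitt_of x2 = fitt_of y.
  apply: fitt_of_eqrel => c; split=> [/(congr1 fst)|E].
    rewrite sum1 => E; apply: i_inj; rewrite linear0 linear_sum -[RHS]E.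
    by apply: eq_bigr => j _; rewrite linearZZ.
  rewrite [LHS]surjective_pairing sum1 sum2 x2_2; congr (_, _).
  have /(congr1 i) := E; rewrite linear0 linear_sum => E'.
  by rewrite -[RHS]E'; apply: eq_bigr => j _; rewrite linearZZ.
have z1x1 c : \sum_j c j *: q1 (z1 j) = 0 -> lspan (range x1) (\sum_j c j *: z1 j).
  move=> cz; apply: x1_ker; last by rewrite -[RHS]cz; apply: sum1.
  by rewrite linear_sum big1 // => j _; rewrite linearZZ dz1 scaler0.
have z2x2 c : \sum_j c j *: q2 (z2 j) = 0 -> lspan (range x2) (\sum_j c j *: z2 j).
  move=> cz; apply: x2_ker; last by rewrite -[RHS]cz; apply: sum2.
  by rewrite linear_sum big1 // => j _; rewrite linearZZ dz2 scaler0.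
have q1x1 l : q1 (x1 l) = 0 by [].
have q2x2 l : q2 (x2 l) = 0 by [].
(* The relations of the single generator [e0] are the multiples of [g], so [g] and its rational
   inverse give a dual basis of size one. *)
have kPhi0 : dual_basis (@gratr G) (q2 \o z2) (g%:M : 'M[ZG]_1) (gV%:M : 'M[QG]_1).
  split=> [j|v|].
  - rewrite big_ord1 /= !mxE (ord1 j) eqxx mulr1n; apply/e0_rel.
    by exists 1; rewrite mul1r.
  - rewrite big_ord1 /= => /e0_rel[c vE]; exists (c%:M).
      by apply/rowP => j; rewrite -scalar_mxM !mxE (ord1 j) eqxx mulr1n.
    apply/rowP => j; rewrite mul_mx_scalar !mxE !(ord1 j) eqxx !mulr1n.
    by rewrite vE rmorphM mulrC -mulrA [gratr g * _]mulrC gVK mulr1.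
  by rewrite map_scalar_mx -scalar_mxM gVK.
have gF : fitt_of (q2 \o z2) g.
  rewrite -[g](det_scalar1); apply: fitt_of_incl => j.
  rewrite big_ord1 /= !mxE (ord1 j) eqxx mulr1n; apply/e0_rel.
  by exists 1; rewrite mul1r.
have [ts tsE] := dual_basis_minors kPhi.
have key1 c t : fitt_of (fcat z1 x1) c ->
    exists2 d, fitt_of x0 d & \det (colsub t Phi) * gratr c = gratr d.
  by rewrite -Fx1; apply: (fitt_of_ext_minor q1x1 z1x1); exact: kPhi.
have key2 c : fitt_of (fcat z1 x1) c ->
    exists2 d, fitt_of y d & gV * gratr c = gratr d.
  rewrite W12 -Fx2 => cW.
  have [d dx dE] := fitt_of_ext_minor q2x2 z2x2 [ffun j => j] kPhi0 cW.
  exists d => //; rewrite -dE; congr (_ * _).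
  by rewrite det_mx11 !mxE ffunE eqxx mulr1n.
apply/seteqP; split.
  apply: lspan_ind.
    by exists 0; rewrite ?rmorph0 ?mulr0 //; apply: ideal_gen0.
  move=> c _ v [u [_ [uV [f fy <-] ->]]] [a' a'x a'E].
  have [d dx dE] : exists2 d, fitt_of x0 d & gratr g * (u * gratr f) = gratr d.
    have fgW : fitt_of (fcat z1 x1) (f * g).
      by rewrite W12; apply: (fitt_of_extM z2x2); rewrite ?Fx2.
    (* Inserting the identity [tsE]: [u] times a minor of [k] is integral, and [f * g] lies in the
       Fitting ideal of the fibre product, so [key1] applies to each term. *)
    have -> : gratr g * (u * gratr f) = \sum_(t <- ts)
        (u * gratr (\det (rowsub t k))) * (\det (colsub t Phi) * gratr (f * g)).
      rewrite -[LHS]mulr1 -tsE mulr_sumr; apply: eq_bigr => t _.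
      by rewrite rmorphM; ring.
    elim: (ts) => [|t ts' [d dx dE]].
      by exists 0; rewrite ?big_nil ?rmorph0 //; apply: ideal_gen0.
    have [d1 d1x d1E] := key1 _ t fgW.
    have [d2 _ d2E] := uV _ (imageP (@gratr G) (fitt_of_rowsub t kPhi)).
    exists (d2 * d1 + d).
      by apply: ideal_genD => //; apply: ideal_genMl.
    by rewrite big_cons dE d1E rmorphD rmorphM /= d2E.
  exists (c * d + a'); first by apply: ideal_genD => //; apply: ideal_genMl.
  rewrite rmorphD rmorphM /= -dE -a'E /= mulrDr; congr (_ + _).
  by rewrite /GRing.scale /= /gratr_scale mulrCA.
move=> v [a' a'x a'E].
(* Here [a' * \det (rowsub t k)] lies in the Fitting ideal of the fibre product, and [key2] divides
   it by [g] inside the Fitting ideal of [Y]. *)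
have -> : v = \sum_(t <- ts) \det (colsub t Phi) *
    (gV * gratr (a' * \det (rowsub t k))).
  rewrite -[LHS]mul1r -gVK -mulrA a'E -[LHS]mulr1 -tsE mulr_sumr.
  by apply: eq_bigr => t _; rewrite rmorphM; ring.
apply: lspan_sum => t _; apply: lspan_incl.
have [|d dy dE] := key2 (a' * \det (rowsub t k)).
  by apply: (fitt_of_extM z1x1); rewrite ?Fx1 //; apply: fitt_of_rowsub kPhi.
exists (\det (colsub t Phi)), (gratr d); split; last by rewrite dE.
  move=> _ [c cz <-]; have [d' ->] := fitt_of_minor_frac t kPhi cz.
  by exists d'.
by exists d.
Qed.

End Comparison.

(** * The module Z[G/I]/(g) *)

Section QuotientMaps.
Variables (R : comNzRingType) (M : lmodType R) (S : set M).

Lemma lquot_pi_linear : linear (@lquot_pi R M S).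
Proof. by move=> a x y; rewrite lquot_piD -lquot_piZ. Qed.

HB.instance Definition _ := GRing.isLinear.Build R M (lquot S) *:%R
  (@lquot_pi R M S) lquot_pi_linear.

Lemma lquot_pi_eq0 x : @lquot_pi R M S x = 0 <-> lspan S x.
Proof.
rewrite -(linear0 (@lquot_pi R M S)); split=> [E|/lspanbP Sx].
  by apply/lspanbP; rewrite -[x]subr0 Quotient.idealrBE; apply/eqP.
by apply/eqP; rewrite -Quotient.idealrBE subr0.
Qed.

Variables (N : lmodType R) (f : {linear M -> N}).
Hypothesis fS : forall x, S x -> f x = 0.

Definition lquot_lift (u : lquot S) : N :=
  f (repr (u : @Quotient.quot M (lspanb S))).

Lemma lquot_liftE x : lquot_lift (lquot_pi S x) = f x.
Proof.
have f0 y : lspan S y -> f y = 0.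
  move: y; apply: lspan_ind; first exact: linear0.
  by move=> a y z Sy fz; rewrite linearP fS // scaler0 fz addr0.
apply/eqP; rewrite -subr_eq0 -linearB; apply/eqP/f0/lspanbP.
by rewrite Quotient.idealrBE reprK.
Qed.

Lemma lquot_lift_linear : linear lquot_lift.
Proof.
move=> a u v; have [x ->] := lquot_pi_surj u; have [y ->] := lquot_pi_surj v.
by rewrite -linearP !lquot_liftE linearP.
Qed.

End QuotientMaps.

(** * The lift of g to Z[G] and the quotient by it *)

Section Frobenius.
Variables (G : finAbGroupType) (I : {group G}) (phit : G).
Local Notation ZG := (gring int G).
Local Notation QG := (gring rat G).

(* A lift of [gA] to Z[G]; unlike [1 - phit^-1 + nu_I], it is regular. *)
Definition frob : ZG := 1 - gelt int phit^-1%g + #|I|%:R.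

Lemma gproj_gelt x : gproj I (gelt int x) = gelt int (coset I x).
Proof.
apply: gringP => y; rewrite gprojE gcoef_elt.
have [->|yx] := eqVneq y (coset I x).
  rewrite (bigD1 x) //= big1 ?addr0 => [|z /andP[_ /negbTE zx]].
    by rewrite gcoef_elt eqxx.
  by rewrite gcoef_elt zx.
rewrite big1 // => z /eqP zy; rewrite gcoef_elt; case: eqP => // zx.
by rewrite -zy zx eqxx in yx.
Qed.

Lemma gproj_frob : gproj I frob = gA (coset I phit).
Proof.
rewrite rmorphD rmorphB rmorph1 rmorph_nat /= gproj_gelt.
by rewrite morphV ?abg_norm.
Qed.

(** With [a = #|I| + 1] and [y] of order d, [a - y] divides [a ^ d - y ^ d = a ^ d - 1], a positive
    integer. *)
Lemma frob_norm : exists w N, (0 < N)%N /\ w * frob = N%:R.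
Proof.
set y := phit^-1%g; set a := #|I|.+1.
have frobE : frob = a%:R - gelt int y by rewrite /frob /a -natr1; ring.
have geltX k : gelt int y ^+ k = gelt int (y ^+ k)%g.
  by elim: k => [|k IHk]; rewrite ?expr0 ?expg0 // exprS expgS geltM IHk.
exists (\sum_(i < #[y]%g) a%:R ^+ (#[y]%g.-1 - i) * gelt int y ^+ i).
exists (a ^ #[y]%g - 1)%N; split.
  rewrite subn_gt0 -{1}(exp1n #[y]%g) ltn_exp2r ?order_gt0 //.
  by rewrite /a ltnS cardG_gt0.
rewrite frobE mulrC -subrXX geltX expg_order gelt1 natrB ?natrX //.
by rewrite expn_gt0.
Qed.

Lemma frob_inv : exists v : QG, v * gratr frob = 1.
Proof.
have [w [N [N0 wN]]] := frob_norm; exists (gconst G (N%:R^-1 : rat) * gratr w).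
by rewrite -mulrA -rmorphM /= wN rmorph_nat gconst_natV.
Qed.

Lemma frob_reg b : frob * b = 0 -> b = 0.
Proof.
move=> fb; have [v vf] := frob_inv; apply: gratr_inj.
by rewrite rmorph0 -[LHS]mul1r -vf -mulrA -rmorphM /= fb rmorph0 mulr0.
Qed.

Local Notation P0 := (cyc_quot frob).

Definition cyc_pi : ZG -> P0 := lquot_pi ([set frob] : set ZG^o).

Lemma cyc_piZ a b : cyc_pi (a * b) = a *: cyc_pi b.
Proof. by rewrite /cyc_pi -[a * b]/(a *: (b : ZG^o)) linearZZ. Qed.

Lemma cyc_pi_sum n (a t : 'I_n -> ZG) :
  \sum_j a j *: cyc_pi (t j) = cyc_pi (\sum_j a j * t j).
Proof.
rewrite /cyc_pi linear_sum; apply: eq_bigr => j _; exact/esym/cyc_piZ.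
Qed.

Lemma cyc_pi_eq0 a : cyc_pi a = 0 <-> exists c, a = c * frob.
Proof.
rewrite /cyc_pi lquot_pi_eq0; split=> [|[c ->]]; last first.
  by apply: (@lspanZ _ ZG^o); apply: lspan_incl.
move: a; apply: (@lspan_ind _ ZG^o); first by exists 0; rewrite mul0r.
by move=> c _ _ -> [d ->]; exists (c + d); rewrite mulrDl.
Qed.

Lemma cyc_pi_surj u : exists a, u = cyc_pi a.
Proof. exact: (@lquot_pi_surj ZG ZG^o [set frob] u). Qed.

Lemma cyc_pi1 b : b *: cyc_pi 1 = cyc_pi b.
Proof. by rewrite -cyc_piZ mulr1. Qed.

Lemma cyc_finite : finite_set [set: P0].
Proof.
have [w [N [N0 wN]]] := frob_norm.
suff -> : [set: P0] = (cyc_pi \o @gresidue G N) @` setT.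
  exact/finite_image/finite_finset.
apply/seteqP; split=> // u _; have [a ->] := cyc_pi_surj u.
have [t [a' aE]] := gresidue_decomp a N0.
exists t => //=; rewrite aE /cyc_pi linearD /=.
have -> : lquot_pi ([set frob] : set ZG^o) (N%:R * a') = 0; last by rewrite addr0.
by apply/cyc_pi_eq0; exists (w * a'); rewrite -wN; ring.
Qed.

Lemma cyc_pd_le1 : pd_le1 P0.
Proof.
pose d : {linear 'rV[ZG]_1 -> 'rV[ZG]_1} :=
  rowcomb (fun j => frob *: delta_mx 0 j).
pose e : {linear 'rV[ZG]_1 -> P0} := rowcomb (fun _ : 'I_1 => cyc_pi 1).
have dE v : d v = frob *: v.
  rewrite /d /= /rowcomb big_ord1; apply/rowP => j.
  by rewrite !mxE !(ord1 j) eqxx mulr1 mulrC.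
have eE v : e v = cyc_pi (v 0 0) by rewrite /e /= /rowcomb big_ord1 cyc_pi1.
exists 'rV[ZG]_1, 'rV[ZG]_1, d, e.
split; [exact: row_projective|exact: row_projective|split].
- move=> u v; rewrite !dE => /eqP; rewrite -subr_eq0 -scalerBr => /eqP/rowP E.
  apply/rowP => j; apply/eqP; rewrite -subr_eq0; apply/eqP/frob_reg.
  by have := E j; rewrite !mxE.
- move=> u; have [a ->] := cyc_pi_surj u; exists (a%:M).
  by rewrite eE mxE eqxx mulr1n.
move=> v; rewrite eE; split=> [/cyc_pi_eq0[c cE]|[u <-]].
  exists (c%:M); rewrite dE; apply/rowP => j.
  by rewrite !mxE (ord1 j) eqxx mulr1n cE mulrC.
by apply/cyc_pi_eq0; exists (u 0 0); rewrite dE mxE mulrC.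
Qed.

Let phi := coset I phit.

Definition mod_proj (a : ZG^o) : modA phi :=
  lquot_pi ([set gA phi] : set (gring int (coset_of I))^o) (gproj I a).

Lemma mod_proj_linear : linear mod_proj.
Proof.
move=> a x y; rewrite /mod_proj -[a *: x]/(a * x) rmorphD rmorphM /=.
by rewrite linearD -[gproj I a * _]/(gproj I a *: (gproj I x : _^o)) linearZZ.
Qed.

HB.instance Definition _ := GRing.isLinear.Build ZG ZG^o (modA phi) *:%R mod_proj
  mod_proj_linear.

Lemma mod_proj_eq0 a : mod_proj a = 0 <->
  exists c b, gsum int I * b = 0 /\ a = c * frob + b.
Proof.
rewrite /mod_proj lquot_pi_eq0; split=> [|[c [b [/gproj_eq0 b0 ->]]]]; last first.
  rewrite rmorphD rmorphM /= b0 addr0 gproj_frob.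
  by apply: (@lspanZ _ (gring int (coset_of I))^o); apply: lspan_incl.
suff gen v : lspan ([set gA phi] : set (gring int (coset_of I))^o) v ->
    exists c, v = gproj I c * gA phi.
  case/gen=> c cE; exists c, (a - c * frob); split; last by rewrite addrC subrK.
  by apply/gproj_eq0; rewrite rmorphB rmorphM /= cE gproj_frob subrr.
move: v; apply: lspan_ind; first by exists 0; rewrite rmorph0 mul0r.
move=> r _ _ -> [c ->].
have [c' <-] := gproj_surj r.
by exists (c' + c); rewrite rmorphD mulrDl.
Qed.

Lemma mod_proj_surj u : exists a, mod_proj a = u.
Proof.
have [r ->] := @lquot_pi_surj _ _ ([set gA phi] : set (gring int (coset_of I))^o) u.
by have [a <-] := gproj_surj r; exists a.
Qed.

Lemma mod_proj_frob x : ([set frob] : set ZG^o) x -> mod_proj x = 0.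
Proof.
by move=> ->; apply/mod_proj_eq0; exists 1, 0; rewrite mulr0 mul1r addr0.
Qed.

HB.instance Definition _ := GRing.isLinear.Build ZG (lquot ([set frob] : set ZG^o))
  (modA phi) *:%R (lquot_lift mod_proj)
  (lquot_lift_linear mod_proj_frob).

(** By [Fitt1_compare] every admissible sequence gives this fractional ideal. The sequence with
    middle term Z[G]/(f) shows that there is one, so [xget] does not return its default. *)
Lemma Fitt1_modA s (t : 'I_s -> ZG) :
  (forall l, gsum int I * t l = 0) ->
  (forall b, gsum int I * b = 0 -> ideal_gen (range t) b) ->
  Fitt1 (modA phi) =
  [set v | exists2 a, fitt_of (cyc_pi \o t) a & gratr frob * v = gratr a].
Proof.
move=> It tgen; have [gV gVK] := frob_inv.
pose p0 : {linear P0 -> modA phi} := lquot_lift mod_proj.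
have p0E a : p0 (cyc_pi a) = mod_proj a by apply: lquot_liftE; apply: mod_proj_frob.
have p0_surj x : exists u, p0 u = x.
  by have [a <-] := mod_proj_surj x; exists (cyc_pi a); rewrite p0E.
have p0t l : p0 ((cyc_pi \o t) l) = 0.
  by rewrite p0E; apply/mod_proj_eq0; exists 0, (t l); rewrite mul0r add0r It.
have p0_ker u : p0 u = 0 -> lspan (range (cyc_pi \o t)) u.
  have [a ->] := cyc_pi_surj u; rewrite p0E => /mod_proj_eq0[c [b [b0 ->]]].
  have /(@lspan_rangeP _ ZG^o)[d ->] := tgen b b0.
  apply/lspan_rangeP; exists d; rewrite cyc_pi_sum /cyc_pi linearD /=.
  have -> : lquot_pi ([set frob] : set ZG^o) (c * frob) = 0.
    by apply/cyc_pi_eq0; exists c.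
  by rewrite add0r.
have member (Y P : lmodType ZG) (i : {linear Y -> P}) (p : {linear P -> modA phi}) :
    finite_set [set: Y] -> finite_set [set: P] -> pd_le1 P -> short_exact i p ->
    fracM (fracV (@gratr G @` Fitt P)) (@gratr G @` Fitt Y) =
    [set v | exists2 a, fitt_of (cyc_pi \o t) a & gratr frob * v = gratr a].
  move=> Yfin Pfin Ppd ip.
  apply: (Fitt1_compare Yfin Pfin Ppd ip gVK (e0 := cyc_pi 1) _ _ p0_surj p0t p0_ker).
    by move=> u; have [a ->] := cyc_pi_surj u; exists a; rewrite cyc_pi1.
  by move=> b; rewrite cyc_pi1 cyc_pi_eq0.
rewrite /Fitt1; case: xgetP => [F _ [Y [P [i [p [Yfin Pfin Ppd ip ->]]]]]|none].
  exact: (member Y P i p Yfin Pfin Ppd ip).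
pose Y : lmodType ZG := lsub (range (cyc_pi \o t)).
pose i : {linear Y -> P0} := val.
have ip : short_exact i p0.
  split=> //; first exact: val_inj.
  move=> u; split=> [/p0_ker/lspanbP ut|[[v vt] <-]]; first by exists (LSub ut).
  rewrite -[i _]/v; have /lspanbP/lspan_rangeP[c ->] := vt.
  by rewrite linear_sum big1 // => l _; rewrite linearZZ p0t scaler0.
have Yfin : finite_set [set: Y].
  rewrite (_ : setT = i @^-1` setT) //; apply: finite_preimage; last exact: cyc_finite.
  by move=> u v _ _; apply: val_inj.
case: (none (fracM (fracV (@gratr G @` Fitt P0)) (@gratr G @` Fitt Y))).
exists Y, P0, i, p0; split=> //; [exact: cyc_finite|exact: cyc_pd_le1].
Qed.

End Frobenius.

(** * The computation *)

Section GratrFacts.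
Variable G : finAbGroupType.

Lemma gratr_gelt x : gratr (gelt int x) = gelt rat x :> gring rat G.
Proof. by apply: gringP => y; rewrite gratrE !gcoef_elt; case: eqP. Qed.

Lemma gratr_gsum (H : {group G}) : gratr (gsum int H) = gsum rat H.
Proof. by rewrite rmorph_sum; apply: eq_bigr => x _; rewrite -gratr_gelt. Qed.

Lemma gsumM_sub (R : comNzRingType) (H K : {group G}) : H \subset K ->
  gsum R H * gsum R K = #|H|%:R * gsum R K.
Proof.
move=> HK; rewrite {1}/gsum mulr_suml -sumr_const mulr_suml.
apply: eq_bigr => h hH; rewrite mul1r gelt_gsum //.
exact: (fintype.subsetP HK).
Qed.

Lemma aug_kerE (D : {group G}) x : aug_ker D x <-> gsum int D * x = 0.
Proof. exact: gproj_eq0. Qed.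

End GratrFacts.

Section MainComputation.
Variables (G : finAbGroupType) (I D : {group G}) (phit : G).
Local Notation ZG := (gring int G).
Local Notation QG := (gring rat G).
Hypotheses (I_sub_D : I \subset D) (phit_D : phit \in D).
Hypothesis phit_gen : generator (D / I)%g (coset I phit).
Variables (s : nat) (Is : 'I_s -> {group G}) (sg : 'I_s -> G).
Hypothesis Is_sg : forall l, Is l = <[sg l]>%g :> {set G}.
Hypothesis Is_prod : \big[dprod/1%g]_(l < s) (Is l : {set G}) = I.

Local Notation nuI := (gsum int I).
Local Notation g := (frob I phit).
Local Notation e := (idem_frob I phit).
Local Notation h := (elt_h I phit).
Let t l : ZG := gelt int (sg l) - 1.
Let nu l : ZG := gsum int (Is l).
Let F0 := fitt_of (cyc_pi I phit \o t).
(** Congruent to [g] modulo nu_I but, unlike [g], in the kernel of Z[G] -> Z[G/D], as both [g] and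
    nu_I map to the integer #I there. *)
Let gam : ZG := g - nuI.
Let target : set QG := frac_gen ([set gsum rat I] `|`
  [set (1 - e) * gratr x | x in Jideal D Is]).

Let nu_prod : nuI = \prod_l nu l.
Proof. exact: gsum_bigdprod. Qed.

Let nu_t l : nu l * t l = 0.
Proof. by apply: gsum_aug0; rewrite Is_sg cycle_id. Qed.

Let nuI_t l : nuI * t l = 0.
Proof. by apply/gsum_aug0/(sg_mem Is_sg Is_prod). Qed.

Let t_gen b : nuI * b = 0 -> ideal_gen (range t) b.
Proof. exact: (ker_gproj_sg Is_sg Is_prod). Qed.

Let e_nu : e * gratr nuI = gelt rat phit^-1%g * gratr nuI.
Proof.
rewrite /idem_frob gratr_gsum; set c := gconst _ _; set x := gelt _ _.
transitivity (c * (gsum rat I * gsum rat I) * x); first by ring.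
rewrite gsumM_sub // mulrA gconst_natV ?cardG_gt0 // mul1r.
by rewrite mulrC.
Qed.

(** On nu_I, [e] acts as phit^-1 and nu_I itself as the integer #I, so [h] acts as [g]. *)
Let h_nu : h * gratr nuI = gratr g * gratr nuI.
Proof.
have nn : gsum rat I * gratr nuI = #|I|%:R * gratr nuI.
  by rewrite gratr_gsum gsumM_sub.
rewrite /elt_h mulrDl mulrBl e_nu nn /frob rmorphD rmorphB rmorph1 rmorph_nat /=.
by rewrite gratr_gelt; ring.
Qed.

Let hE : h = 1 - e + gratr nuI.
Proof. by rewrite gratr_gsum. Qed.

Let gamD : aug_ker D gam.
Proof.
apply/aug_kerE; rewrite /gam /frob !mulrBr !mulrDr mulrN mulr1.
rewrite [X in _ - X]mulrC gsumM_sub // [gsum int D * gelt _ _]mulrC.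
by rewrite gelt_gsum ?groupV //; ring.
Qed.

Let tD l : aug_ker D (t l).
Proof.
apply/aug_kerE/gsum_aug0/(fintype.subsetP I_sub_D); exact: (sg_mem Is_sg Is_prod).
Qed.

Let aug_kerD x y : aug_ker D x -> aug_ker D y -> aug_ker D (x + y).
Proof. by rewrite /aug_ker /= rmorphD /= => -> ->; rewrite addr0. Qed.

Let aug_kerM a x : aug_ker D x -> aug_ker D (a * x).
Proof. by rewrite /aug_ker /= rmorphM /= => ->; rewrite mulr0. Qed.

Let augI_D u : ideal_gen (range t) u -> aug_ker D u.
Proof.
move: u; apply: ideal_gen_ind; first by rewrite /aug_ker /= rmorph0.
by move=> a _ y [l _ <-] Dy; apply/aug_kerD => //; apply: aug_kerM.
Qed.

Let T' : set ZG := range t `|` [set gam].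

Let T'_t : ideal_gen (range t) `<=` ideal_gen T'.
Proof. by apply: ideal_gen_sub => x tx; apply: ideal_gen_incl; left. Qed.

(** The group [D] is generated by [I] and [phit]. The [t l] account for [I], and [gam] is
    [1 - phit^-1] up to elements of their ideal. *)
Let aug_ker_gen x : aug_ker D x -> ideal_gen T' x.
Proof.
move/aug_kerE/ker_gproj_gen; apply: ideal_gen_sub => _ [d dD <-].
have T'I y : y \in I -> ideal_gen T' (gelt int y - 1).
  by move=> yI; apply/T'_t/(aug_gens int Is_sg Is_prod).
have phiB : phit^-1%g \in Group (@aug_group int G T').
  rewrite finset.in_set; apply/asboolP.
  have -> : gelt int phit^-1%g - 1 = - gam - \sum_(y in I) (gelt int y - 1).
    by rewrite sumrB sumr_const -/(gsum int I) /gam /frob; ring.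
  apply: ideal_genD.
    by apply/ideal_genN/ideal_gen_incl; right.
  by apply/ideal_genN/ideal_gen_sum => y yI; apply: T'I.
suff : d \in Group (@aug_group int G T') by rewrite finset.in_set => /asboolP.
rewrite groupV in phiB.
have : coset I d \in (D / I)%g by rewrite mem_quotient.
rewrite (eqP phit_gen) => /cycleP[k]; rewrite -morphX ?abg_norm //.
move/eqP; rewrite coset_eqE => dI.
rewrite -[d](mulgKV (phit ^+ k)%g) groupM ?groupX // finset.in_set.
by apply/asboolP/T'I.
Qed.

(** A relation reads [\sum_j c j * t j = b * g]. Multiplying by nu_I and cancelling the regular [g]
    gives [nuI * b = 0], so [b] is a combination of the [t j] with coefficients [E j], and
    [c j - g * E j] is a syzygy. *)
Let rel_decomp (c : 'I_s -> ZG) :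
  \sum_j c j *: (cyc_pi I phit \o t) j = 0 ->
  exists (C E : 'I_s -> ZG) (S : 'I_s -> 'I_s -> ZG),
    [/\ forall k j, S k j = - S j k, forall k, S k k = 0
      & forall j, c j = C j * nu j + \sum_k t k * S k j + g * E j].
Proof.
rewrite cyc_pi_sum => /cyc_pi_eq0[b bE].
have /t_gen/(@lspan_rangeP _ ZG^o)[E EE] : nuI * b = 0.
  apply: (@frob_reg G I phit); rewrite mulrC -mulrA -bE mulr_sumr big1 // => j _.
  by rewrite mulrCA nuI_t mulr0.
have {}EE : b = \sum_j E j * t j by [].
have [|C [S [S1 S2 SE]]] :=
    sg_syzygies Is_sg Is_prod (a := fun j => c j - g * E j).
  under eq_bigr => j _ do rewrite mulrBl.
  rewrite sumrB bE EE mulr_suml -sumrB big1 // => j _.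
  by rewrite -/(t j); ring.
exists C, E, S; split=> // j; apply: (@addIr _ (- (g * E j))).
by rewrite addrK; apply: SE.
Qed.

Let target_nu (x : ZG) : target (gratr nuI * gratr x).
Proof.
rewrite mulrC -[gratr x * _]/(x *: (gratr nuI : QG)); apply/lspanZ/lspan_incl.
by left; rewrite gratr_gsum.
Qed.

Let target_J x : Jideal D Is x -> target ((1 - e) * gratr x).
Proof. by move=> Jx; apply: lspan_incl; right; exists x. Qed.

Let one_sub_e_nu x : (1 - e) * gratr (nuI * x) =
  gratr nuI * gratr ((1 - gelt int phit^-1%g) * x).
Proof.
rewrite !rmorphM rmorphB rmorph1 /= gratr_gelt.
transitivity (gratr x * (gratr nuI - e * gratr nuI)); first by ring.
by rewrite e_nu; ring.
Qed.

Let shift_prod (J : Type) (r : seq J) (P : pred J) (A B : J -> ZG) :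
  (forall j, exists z, A j = B j + nuI * z) ->
  exists z, \prod_(j <- r | P j) A j = \prod_(j <- r | P j) B j + nuI * z.
Proof.
move=> AB; elim/big_rec2: _ => [|j b a _ [z ->]].
  by exists 0; rewrite mulr0 addr0.
have [y ->] := AB j; exists (B j * z + y * b + y * nuI * z); ring.
Qed.

(** One inclusion, with the denominator [g] cleared. In the expansion by [koszul_det] the term nu_I
    is settled by [h_nu]. In the others the factor [g] of one column cancels; then [h] is replaced
    by [1 - e] and each remaining [g] by [gam], at the cost of multiples of nu_I. *)
Let fitt_target a : F0 a -> exists2 r, target r & gratr g * r = h * gratr a.
Proof.
have Q0 : exists2 r, target r & gratr g * r = h * gratr (0 : ZG).
  by exists 0; [exact: lspan0|rewrite rmorph0 !mulr0].
have QD b x y : (exists2 r, target r & gratr g * r = h * gratr x) ->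
    (exists2 r, target r & gratr g * r = h * gratr y) ->
    exists2 r, target r & gratr g * r = h * gratr (b * x + y).
  move=> [r1 T1 E1] [r2 T2 E2]; exists (b *: r1 + r2).
    by apply: lspanD => //; apply: lspanZ.
  rewrite -[b *: r1]/(gratr b * r1) mulrDr E2 mulrCA E1.
  by rewrite [in RHS]rmorphD [in RHS]rmorphM /=; ring.
move: a; apply: ideal_gen_ind => // b _ y [B [Brel ->]] Qy; apply: (QD) => //.
have /fin_all_exists[C /fin_all_exists[E /fin_all_exists[S SE]]] i :=
  rel_decomp (Brel i).
have -> : B = \matrix_(i, j)
    ((\matrix_(i, j) C i j) i j * nu j + \sum_k t k * S i k j +
     g * (\matrix_(i, j) E i j) i j).
  by apply/matrixP => i j; have [_ _ BE] := SE i; rewrite !mxE BE.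
pose Q (a : ZG) := exists2 r, target r & gratr g * r = h * gratr a.
apply: (@koszul_det _ s nu t g nu_t Q _ _ S _ _ Q0 QD).
- by move=> i; have [] := SE i.
- by move=> i; have [] := SE i.
- exists (gratr nuI); last by rewrite -nu_prod h_nu.
  by rewrite -[gratr nuI]mulr1 -(rmorph1 (@gratr G)); apply: target_nu.
move=> f u i fi ut.
(* The norm columns form [L], column [i] gives the [g] to be cancelled, and the columns in [A]
   contribute elements of [aug_ker D] modulo nu_I. *)
pose L := [set j | val (f j) == 0%N]%SET; pose A := ~: L :\ i.
have iL : i \in ~: L by rewrite !inE fi.
pose y0 := \prod_(j in A) koszul_factor nu g f u j.
have -> : \prod_j koszul_factor nu g f u j = g * (\prod_(l in L) nu l * y0).
  rewrite (bigID (mem L)) /= mulrCA; congr (_ * _).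
    by apply: eq_bigr => j; rewrite inE /koszul_factor => /eqP->.
  rewrite (bigD1 i) /=; last by move: iL; rewrite finset.in_setC.
  rewrite {1}/koszul_factor fi; congr (_ * _); apply: eq_bigl => j.
  by rewrite !inE andbC.
exists (h * gratr (\prod_(l in L) nu l * y0)); last first.
  by rewrite [in RHS]rmorphM mulrCA.
rewrite {1}hE mulrDl; apply: lspanD; last exact: target_nu.
have [z ->] : exists z, y0 =
    \prod_(j in A) koszul_factor nu gam f u j + nuI * z.
  rewrite /y0; apply: shift_prod => j; rewrite /koszul_factor.
  case: (val (f j)) => [|[|m]]; [exists 0|exists 0|exists 1];
    rewrite ?mulr0 ?addr0 // mulr1 /gam subrK //.
rewrite mulrDr rmorphD mulrDr; apply: lspanD; last first.
  by rewrite mulrCA one_sub_e_nu; apply: target_nu.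
(* For this index there are [#|L|] norms, and the exponent is [#|A| = #|~: L| - 1]. *)
apply/target_J/ideal_gen_incl; exists #|~: L|; split.
  apply/andP; split; first by apply/card_gt0P; exists i.
  by rewrite -[X in (_ <= X)%N]card_ord max_card.
apply: idealM_incl.
  apply: ideal_gen_incl; exists L; split=> //.
  by rewrite -(addnK #|~: L| #|L|) cardsC card_ord.
rewrite (cardsD1 i) iL -/A /= cardE -big_enum /=.
rewrite (eq_big_seq (fun j => if val (f j) == 1%N then u j else gam)).
  apply: idealX_prod => j; case: ifP => _ //; exact: augI_D.
move=> j; rewrite mem_enum !inE /koszul_factor => /andP[_].
by case: (val (f j)) => [|[|m]].
Qed.

Let fitt_koszul (L : {set 'I_s}) w :
  {subset w <= ~: L} -> (size w <= #|~: L|.-1)%N ->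
  F0 (\prod_(l in L) nu l * (g ^+ (#|~: L| - size w) * \prod_(l <- w) t l)).
Proof.
apply: koszul_fitt => //= [l|l c|l]; rewrite -?cyc_piZ ?nu_t.
- by apply/cyc_pi_eq0; exists (t l); rewrite mulrC.
- by rewrite mulrC.
by apply/cyc_pi_eq0; exists 0; rewrite mul0r.
Qed.

Let F0_nu x : F0 (nuI * x).
Proof.
apply: ideal_genMr; have := @fitt_koszul [set: 'I_s]%SET [::].
rewrite finset.setCT cards0 /= subnn expr0 big_nil !mulr1 => /(_ _ isT).
rewrite nu_prod (eq_bigl predT) => [E|l]; last by rewrite inE.
by apply: E => l; rewrite in_nil.
Qed.

(** Membership in h g^-1 [F0], with the denominator cleared. *)
Let inF (v : QG) := exists2 a, F0 a & gratr g * v = h * gratr a.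

Let inF_lin (c : ZG) v w : inF v -> inF w -> inF (gratr c * v + w).
Proof.
move=> [a Fa aE] [b Fb bE]; exists (c * a + b).
  by apply: ideal_genD => //; apply: ideal_genMl.
by rewrite mulrDr bE mulrCA aE [in RHS]rmorphD [in RHS]rmorphM /=; ring.
Qed.

Let inF0 : inF 0.
Proof. by exists 0; [exact: ideal_gen0|rewrite rmorph0 !mulr0]. Qed.

Let inF_e_lin (c x y : ZG) : inF ((1 - e) * gratr x) ->
  inF ((1 - e) * gratr y) -> inF ((1 - e) * gratr (c * x + y)).
Proof.
move=> Fx Fy; rewrite rmorphD rmorphM mulrDr mulrCA; exact: inF_lin.
Qed.

(** If [w] meets [L] the monomial X is 0. Otherwise [h_nu] gives g (h - nu_I) X = h (g X - nu_I X),
    and g X is, modulo nu_I, the minor of [fitt_koszul]. *)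
Let inF_monomial (L : {set 'I_s}) w m : (size w + m).+1 = #|~: L| ->
  inF ((1 - e) * gratr (\prod_(l in L) nu l * (gam ^+ m * \prod_(l <- w) t l))).
Proof.
move=> szw; set nL := \prod_(l in L) nu l; set tw := \prod_(l <- w) t l.
have [l /andP[lw lL]|wL] := pickP (fun l => (l \in w) && (l \in L)).
  have -> : nL * (gam ^+ m * tw) = 0.
    rewrite /nL (bigD1 l) //= /tw (big_rem l lw) /=.
    by rewrite [gam ^+ m * _]mulrCA mulrACA nu_t mul0r.
  by rewrite rmorph0 mulr0.
have F1 : F0 (nL * (g ^+ m.+1 * tw)).
  have -> : m.+1 = (#|~: L| - size w)%N by rewrite -szw -addnS addKn.
  apply: fitt_koszul; last by rewrite -szw leq_addr.
  by move=> l lw; rewrite inE; have := wL l; rewrite lw /= => ->.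
have [z zE] : exists z, gam ^+ m = g ^+ m + nuI * z.
  rewrite -[m]subn0 -!prodr_const_nat; apply: shift_prod => _; exists (-1).
  by rewrite mulrN1.
exists (nL * (g ^+ m.+1 * tw) +
    nuI * (g * z * nL * tw - nL * (gam ^+ m * tw))).
  by apply: ideal_genD => //; apply: F0_nu.
have -> : 1 - e = h - gratr nuI by rewrite hE addrK.
have hn := h_nu; set X := nL * (gam ^+ m * tw).
have -> : nL * (g ^+ m.+1 * tw) + nuI * (g * z * nL * tw - X) = g * X - nuI * X.
  by rewrite /X zE exprS; ring.
rewrite rmorphB !rmorphM /= mulrBr mulrBl mulrBr; congr (_ - _).
  by rewrite mulrCA.
by rewrite [LHS]mulrA [RHS]mulrA hn.
Qed.

(** Each factor from [aug_ker D] is a combination of the [t l], which are appended to [w], and of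
    [gam], which raises [m]. *)
Let inF_idealX (L : {set 'I_s}) n b w m : idealX (aug_ker D) n b ->
  (n + size w + m).+1 = #|~: L| ->
  inF ((1 - e) *
       gratr (\prod_(l in L) nu l * (gam ^+ m * \prod_(l <- w) t l) * b)).
Proof.
elim: n b w m => [|n IHn] b w m.
  move=> _ szw; rewrite [X in gratr X]mulrC -[X in gratr X]addr0; apply: inF_e_lin.
    exact: inF_monomial.
  by rewrite rmorph0 mulr0.
move=> Xb szw; move: b Xb; apply: ideal_gen_ind; first by rewrite mulr0 rmorph0 mulr0.
move=> c _ y [x [b [Dx Xb ->]]] IHy; rewrite mulrDr mulrCA; apply: inF_e_lin => //.
set Y := (X in gratr (X * _)).
have := aug_ker_gen Dx; move: x {Dx}; apply: ideal_gen_ind.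
  by rewrite mul0r mulr0 rmorph0 mulr0.
move=> c' x y' T'x IHy'.
have -> : Y * ((c' * x + y') * b) = c' * (Y * (x * b)) + Y * (y' * b) by ring.
apply: inF_e_lin => //; rewrite /Y; case: T'x => [[l _ <-]|->].
  have := IHn b (l :: w) m Xb; rewrite big_cons /= addnS -addSn => /(_ szw).
  by congr inF; congr (_ * gratr _); ring.
have := IHn b w m.+1 Xb; rewrite addnS -!addSn => /(_ szw).
by congr inF; congr (_ * gratr _); rewrite exprS; ring.
Qed.

Let target_inF v : target v -> inF v.
Proof.
move: v; apply: lspan_ind; first exact: inF0.
move=> c x y Tx Fy; apply: inF_lin => {Fy}//; case: Tx => [->|[b Jb <-]].
  exists nuI; first by rewrite -[nuI]mulr1.
  by rewrite h_nu gratr_gsum.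
move: b Jb; apply: ideal_gen_ind; first by rewrite rmorph0 mulr0.
move=> c' b y' [i [/andP[i0 si] Zb]] Fy'; apply: inF_e_lin => // {Fy'}.
move: b Zb; apply: ideal_gen_ind; first by rewrite rmorph0 mulr0.
move=> c2 _ y2 [z [b [Zz Xb ->]]] Fy2; apply: inF_e_lin => // {Fy2}.
move: z Zz; apply: ideal_gen_ind; first by rewrite mul0r rmorph0 mulr0.
move=> c3 _ y3 [L [cardL ->]] Fy3.
rewrite [X in gratr X]mulrDl -[c3 * _ * _]mulrA; apply: inF_e_lin => //.
have := @inF_idealX L i.-1 b [::] 0 Xb.
rewrite expr0 big_nil !mulr1 !addn0 prednK // => Fb; apply: Fb.
by apply/eqP; rewrite -(eqn_add2l #|L|) cardsC card_ord cardL subnK.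
Qed.

Lemma main_equality :
  [set h * x | x in Fitt1 (modA (coset I phit))] = target.
Proof.
have [gV gVK] := frob_inv I phit.
rewrite (Fitt1_modA phit nuI_t t_gen); apply/seteqP; split=> [_ [x [a Fa aE] <-]|v].
  have [r Tr rE] := fitt_target Fa.
  suff -> : h * x = r by [].
  by rewrite -[LHS]mul1r -[RHS]mul1r -gVK -!mulrA rE -aE; ring.
move/target_inF => [a Fa aE]; exists (gV * gratr a).
  by exists a => //; rewrite mulrCA mulrA gVK mul1r.
by rewrite mulrCA -aE mulrA gVK mul1r.
Qed.

End MainComputation.

Theorem theorem1p4 (G : finAbGroupType) (I D : {group G})
    (I_sub_D : I \subset D)
    (phi : coset_of I) (phi_gen : generator (D / I)%g phi)
    (phit : G) (phit_D : phit \in D) (phit_lift : coset I phit = phi)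
    (s : nat) (Is : 'I_s -> {group G}) (Is_cyclic : forall l, cyclic (Is l))
    (Is_prod : \big[dprod/1%g]_(l < s) (Is l : {set G}) = (I : {set G})) :
  [set elt_h I phit * x | x in Fitt1 (modA phi)] =
  frac_gen ([set gsum rat I] `|`
            [set (1 - idem_frob I phit) * gratr x | x in Jideal D Is]).
Proof.
have /fin_all_exists[sg sgE] l := cyclicP (Is_cyclic l).
case: _ / phit_lift phi_gen => phi_gen.
exact: (main_equality I_sub_D phit_D phi_gen sgE Is_prod).
Qed.
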